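(* Let $T:\mathbb T^2\to\mathbb T^2$ be $T(x,y)=(x+\alpha,\,y+f(x))$ where $\alpha$ is irrational and $f:\mathbb T\to\mathbb T$ is Lipschitz and homotopically non-trivial. Then for every Borel probability measure $\mu$ on $\mathbb T^2$ whose projection to the first coordinate is Lebesgue measure, and every $\varphi\in C(\mathbb T^2)$, $\lim_{n\to\infty}\int\varphi\circ T^n\,d\mu=\int\varphi\,dm$, where $m$ is Lebesgue measure on $\mathbb T^2$.
   Context: $\mathbb T=\mathbb R/\mathbb Z$. A map $\mathbb T\to\mathbb T$ is homotopically non-trivial if it has nonzero degree. *)

(* Defs.v *)
From HB Require Import structures.
From mathcomp Require Import all_boot all_order all_algebra.
From mathcomp Require Import all_classical all_reals all_analysis.
Set Implicit Arguments. Unset Strict Implicit. Unset Printing Implicit Defensive.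
Import Order.TTheory GRing.Theory Num.Theory.
Import numFieldNormedType.Exports.
Local Open Scope classical_set_scope.
Local Open Scope ring_scope.

(* The torus T = R/Z is modelled through lifts to R: points of T^2 are
   represented by points of R*R, functions on T^2 by Z^2-periodic functions
   on R*R, and measures on T^2 by measures on R*R concentrated on the
   fundamental domain [0,1[ x [0,1[. *)

Definition unit_square (R : realType) : set (R * R) := `[0%R, 1%R[ `*` `[0%R, 1%R[.

(* lift of the skew product T(x,y) = (x + alpha, y + f x), F a lift of f *)
Definition skew_lift (R : realType) (alpha : R) (F : R -> R) (z : R * R) : R * R :=
  (z.1 + alpha, z.2 + F z.1).

(* Main.v *)
Require Import Defs.
From HB Require Import structures.
From mathcomp Require Import all_boot all_order all_algebra.
From mathcomp Require Import all_classical all_reals all_analysis.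
From mathcomp Require Import measurable_realfun ring lra.
Import Order.TTheory GRing.Theory Num.Theory.
Import numFieldNormedType.Exports.
Local Open Scope classical_set_scope.
Local Open Scope ring_scope.

(**
  Write S_n x for the sum of F (x + i alpha), i < n, so that T^n (x, y) =
  (x + n alpha, y + S_n x), and subtract from phi its mean over the vertical
  fibres: the means integrate to m(phi) because the projection of mu is
  invariant under rotation, and it remains to treat psi with zero fibre means.
  Cutting the y-axis into short intervals and disintegrating mu (Radon-Nikodym),
  then approximating the densities in L^1 by continuous functions, reduces the
  claim to: the integral of w (S_n x) over a subinterval of [0, 1] tends to 0,
  uniformly over 1-periodic w of mean zero with |w| <= M.

  If P' = w, then P is bounded and w (S_n) S_n' = (P (S_n))' has a bounded
  integral, so it suffices that S_n' / n tends to the degree d in L^1.  No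
  derivative of F is used: S_n' is replaced by difference quotients at a scale
  h that goes to 0 first.  The quotient of F at scale 1/m is the average of N
  translates of the quotient at scale 1/(mN), so if its L^2 norm is nearly the
  supremum over all scales, then the quotient at scale 1/(mN) is L^2-close to a
  translate of the one at scale 1/m, whatever N is.  The latter is continuous of
  mean d, and its Birkhoff averages converge uniformly because the orbits of an
  irrational rotation are uniformly dense.
*)

(** * Integrals of continuous functions over segments *)

Local Notation segint a b w := (Rintegral (@lebesgue_measure _) `[a, b]%classic w).

Lemma continuous_integrable_itv (R : realType) (a b : R) (w : R -> R) :
  continuous w -> (@lebesgue_measure R).-integrable `[a, b] (EFin \o w).
Proof.
move=> cw; apply: continuous_compact_integrable; first exact: segment_compact.
exact: continuous_subspaceT.
Qed.

Lemma segint_chasles (R : realType) (a b c : R) (w : R -> R) :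
  continuous w -> a <= b -> b <= c -> segint a b w + segint b c w = segint a c w.
Proof.
move=> cw ab bc.
have H := @Rintegral_itvB R w (BLeft a) (BRight c) b
  (continuous_integrable_itv _ _ _ _ cw).
rewrite -[RHS](subrK (segint a b w)) H ?bnd_simp // addrC; congr (_ + _).
rewrite Rintegral_itv_obnd_cbnd //.
apply: (integrableS (mu := lebesgue_measure) (E := `[b, c])) => //.
  by apply: subset_itvr; rewrite bnd_simp.
exact: continuous_integrable_itv.
Qed.

Lemma segint_shift (R : realType) (a b c : R) (w : R -> R) :
  continuous w -> a <= b -> segint a b (fun x => w (x + c)) = segint (a + c) (b + c) w.
Proof.
move=> cw ab; rewrite /Rintegral.
have dE (x : R) : is_derive x 1 (fun y : R => y + c) 1.
  by apply: is_derive_eq; rewrite addr0.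
have d1 : derive1 (fun y : R => y + c) = cst 1.
  by apply/funext => x; rewrite derive1E; exact: (derive_val).
have cc : continuous (fun y : R => y + c).
  by move=> x; apply: cvgD; [exact: cvg_id|exact: cvg_cst].
rewrite (@integration_by_substitution_increasing R (fun y => y + c) w a b ab).
- congr fine; apply: eq_integral => x _ /=; rewrite d1.
  by congr EFin; rewrite /GRing.mul /= mulr1.
- by move=> x y _ _; rewrite ltrD2r.
- by move=> x _; rewrite d1; exact: cst_continuous.
- by rewrite d1; apply: is_cvg_cst.
- by rewrite d1; apply: is_cvg_cst.
- split.
  + by move=> x _; exact: ex_derive.
  + by apply: cvg_at_right_filter; exact: cc.
  + by apply: cvg_at_left_filter; exact: cc.
- exact: continuous_subspaceT.
Qed.

Lemma segint_D (R : realType) (a b : R) (v w : R -> R) :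
  continuous v -> continuous w ->
  segint a b (fun x => v x + w x) = segint a b v + segint a b w.
Proof. by move=> cv cw; rewrite RintegralD //; exact: continuous_integrable_itv. Qed.

Lemma segint_Z (R : realType) (a b r : R) (w : R -> R) :
  continuous w -> segint a b (fun x => r * w x) = r * segint a b w.
Proof. by move=> cw; rewrite RintegralZl //; exact: continuous_integrable_itv. Qed.

Lemma segint_B (R : realType) (a b : R) (v w : R -> R) :
  continuous v -> continuous w ->
  segint a b (fun x => v x - w x) = segint a b v - segint a b w.
Proof. by move=> cv cw; rewrite RintegralB //; exact: continuous_integrable_itv. Qed.

Lemma segint_cst (R : realType) (a b r : R) : a <= b -> segint a b (fun=> r) = r * (b - a).
Proof.
move=> ab; rewrite Rintegral_cst //; congr (_ * _).
apply: etrans (congr1 fine (@lebesgue_measure_itv R (Interval (BLeft a) (BRight b)))) _.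
by rewrite /= lte_fin; case: ltgtP ab => // -> _; rewrite subrr.
Qed.

Lemma segint_le (R : realType) (a b : R) (v w : R -> R) :
  continuous v -> continuous w -> (forall x, a <= x <= b -> v x <= w x) ->
  segint a b v <= segint a b w.
Proof.
move=> cv cw vw; by apply: le_Rintegral => //; exact: continuous_integrable_itv.
Qed.

Lemma continuous_norm (R : realType) (w : R -> R) :
  continuous w -> continuous (fun x => `|w x|).
Proof. by move=> cw x; apply: cvg_norm; exact: cw. Qed.

Lemma continuous_sum (R : realType) n (w : nat -> R -> R) :
  (forall i, continuous (w i)) -> continuous (fun x => \sum_(i < n) w i x).
Proof.
move=> cw; elim: n => [|n IH] x.
  by under eq_fun do rewrite big_ord0; exact: cvg_cst.
under eq_fun do rewrite big_ord_recr /=.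
by apply: continuousD; [exact: IH|exact: cw].
Qed.

Lemma segint_norm (R : realType) (a b : R) (w : R -> R) :
  continuous w -> `|segint a b w| <= segint a b (fun x => `|w x|).
Proof. by move=> cw; apply: le_normr_Rintegral => //; exact: continuous_integrable_itv. Qed.

Lemma segint_bound (R : realType) (a b M : R) (w : R -> R) :
  continuous w -> a <= b -> (forall x, a <= x <= b -> `|w x| <= M) ->
  `|segint a b w| <= M * (b - a).
Proof.
move=> cw ab wM; rewrite -segint_cst //; apply: le_trans (segint_norm _ _ _ _ cw) _.
by apply: segint_le => //; [exact: continuous_norm|exact: cst_continuous].
Qed.

Lemma segint_sum (R : realType) (a b : R) n (w : nat -> R -> R) :
  (forall i, continuous (w i)) ->
  segint a b (fun x => \sum_(i < n) w i x) = \sum_(i < n) segint a b (w i).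
Proof.
move=> cw; elim: n => [|n IH].
  rewrite big_ord0 (_ : (fun _ => _) = fun=> 0 * 0).
    by rewrite segint_Z ?mul0r //; exact: cst_continuous.
  by apply/funext => x; rewrite big_ord0 mulr0.
rewrite big_ord_recr /= -IH -segint_D //; last exact: continuous_sum.
by congr Rintegral; apply/funext => x; rewrite big_ord_recr.
Qed.

Lemma continuous_shiftr (R : realType) (c : R) (w : R -> R) :
  continuous w -> continuous (fun x => w (x + c)).
Proof.
move=> cw x; apply: (@continuous_comp _ _ _ (fun x => x + c) w); last exact: cw.
by apply: cvgD; [exact: cvg_id|exact: cvg_cst].
Qed.

Lemma periodic_nat (R : realType) (V : zmodType) (w : R -> V) (v : V) (k : nat) x :
  (forall x, w (x + 1) = w x + v) -> w (x + k%:R) = w x + v *+ k.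
Proof.
move=> pw; elim: k => [|k IH]; first by rewrite mulr0n !addr0.
by rewrite -addn1 natrD addrA pw IH -addrA -mulrSr addn1.
Qed.

Lemma periodic_int (R : realType) (V : zmodType) (w : R -> V) (v : V) (k : int) x :
  (forall x, w (x + 1) = w x + v) -> w (x + k%:~R) = w x + v *~ k.
Proof.
move=> pw; case: k => k; first exact: periodic_nat.
have := @periodic_nat R V w v k.+1 (x + (Negz k)%:~R) pw.
rewrite NegzE -addrA mulrNz addNr addr0 => ->.
by rewrite mulrNz -addrA addrN addr0.
Qed.

(** After reduction of the shift modulo 1 to some [r] in [0, 1], the window [r, 1 + r] is cut at 1
    and its part beyond 1 is translated back to [0, r]. *)
Lemma segint_periodic_shift (R : realType) (c : R) (w : R -> R) :
  continuous w -> (forall x, w (x + 1) = w x) ->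
  segint 0 1 (fun x => w (x + c)) = segint 0 1 w.
Proof.
move=> cw pw; rewrite segint_shift ?ler01 // add0r.
have [r [r0 r1 [k cE]]] : exists r : R, [/\ 0 <= r, r <= 1 & exists k : int, c = r + k%:~R].
  exists (c - (Num.floor c)%:~R); have /andP[h1 h2] := floor_itv c.
  move: h2; rewrite intrD1 => h2.
  by split; [lra|lra|exists (Num.floor c); rewrite subrK].
have -> : segint c (1 + c) w = segint r (1 + r) w.
  rewrite cE addrA -segint_shift //; last lra.
  congr Rintegral; apply/funext => x.
  by rewrite (@periodic_int R R w 0) ?mul0rz ?addr0 // => y; rewrite addr0.
rewrite -(@segint_chasles R r 1 (1 + r)) //; last lra.
rewrite -(@segint_chasles R 0 r 1) // addrC; congr (_ + _).
rewrite [1 + r]addrC -[X in segint X _ _]add0r -segint_shift //.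
by congr Rintegral; apply/funext => x.
Qed.

(** * Difference quotients of a Lipschitz function *)

Definition ucont (R : realType) (w : R -> R) := forall e : R, 0 < e ->
  exists2 r : R, 0 < r & forall x y, `|x - y| < r -> `|w x - w y| <= e.

Lemma ucont_continuous (R : realType) (w : R -> R) : ucont R w -> continuous w.
Proof.
move=> uw x; apply/cvgrPdist_le => e e0; have [r r0 H] := uw e e0.
by near=> y; apply: H; near: y; apply: cvgr_dist_lt => //; exact: cvg_id.
Unshelve. all: by end_near. Qed.

Lemma lipschitz_ucont (R : realType) (k : R) (w : R -> R) :
  (forall x y, `|w x - w y| <= k * `|x - y|) -> ucont R w.
Proof.
move=> lw e e0; have k0 : 0 < `|k| + 1 by rewrite ltr_wpDl.
exists (e / (`|k| + 1)); first by rewrite divr_gt0.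
move=> x y; rewrite ltr_pdivlMr // => h; apply: le_trans (lw x y) _.
have h1 := ler_norm k; have h2 := normr_ge0 (x - y); nra.
Qed.

Definition dquo (R : realType) (F : R -> R) (h x : R) := (F (x + h) - F x) / h.

Lemma dquo_continuous (R : realType) (F : R -> R) h :
  continuous F -> continuous (dquo R F h).
Proof.
move=> cF x; apply: cvgM; last exact: cvg_cst.
by apply: cvgB; [exact: continuous_shiftr|exact: cF].
Qed.

Lemma dquo_periodic (R : realType) (F : R -> R) h v x :
  (forall x, F (x + 1) = F x + v) -> dquo R F h (x + 1) = dquo R F h x.
Proof. by move=> pF; rewrite /dquo addrAC !pF; congr (_ / _); ring. Qed.

(** The sum telescopes. With N h = 1/m it says that the quotient at scale 1/m is the mean of N
    translates of the one at scale h; with N h = 1 it gives the increment of [F] over a full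
    period. *)
Lemma dquo_avg (R : realType) (F : R -> R) (h x : R) (N : nat) :
  \sum_(s < N) dquo R F h (x + s%:R * h) = (F (x + N%:R * h) - F x) / h.
Proof.
elim: N => [|N IH]; first by rewrite big_ord0 mul0r addr0 subrr mul0r.
rewrite big_ord_recr /= IH /dquo -mulrDl; congr (_ / _).
have -> : x + N.+1%:R * h = x + N%:R * h + h by rewrite -natr1; ring.
by ring.
Qed.

Lemma dquo_bound (R : realType) (F : R -> R) (k h x : R) :
  (forall x y, `|F x - F y| <= k * `|x - y|) -> 0 < h -> `|dquo R F h x| <= k.
Proof.
move=> lF h0; rewrite /dquo normrM normfV (gtr0_norm h0) ler_pdivrMr //.
by apply: le_trans (lF _ _) _; rewrite addrAC subrr add0r gtr0_norm.
Qed.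

(** The variance identity: [v] is the mean of the [a s], so the cross term contributes -2 N v^2. *)
Lemma sum_sqr_dev (R : realType) (a : nat -> R) (N : nat) (v : R) :
  \sum_(s < N) a s = N%:R * v ->
  \sum_(s < N) (v - a s) ^+ 2 = \sum_(s < N) a s ^+ 2 - N%:R * v ^+ 2.
Proof.
move=> sa.
transitivity (\sum_(s < N) (a s ^+ 2 + (v ^+ 2 + (- (2 * v)) * a s))).
  by apply: eq_bigr => s _; ring.
have s2 : \sum_(s < N) (- (2 * v)) * a s = (- (2 * v)) * (N%:R * v).
  by rewrite -sa mulr_sumr.
by rewrite !big_split /= s2 sumr_const card_ord -mulr_natl; ring.
Qed.

Lemma sum_le_exists (R : realType) (a : nat -> R) (N : nat) (v : R) : (0 < N)%N ->
  \sum_(s < N) a s <= N%:R * v -> exists s, a s <= v.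
Proof.
move=> N0 sa; apply: contrapT => /forallNP H; move: sa; apply/negP.
rewrite -ltNge mulr_natl -[X in v *+ X]card_ord -sumr_const.
apply: ltr_sum; first by case: N N0 => // N _; apply/hasP; exists ord0; rewrite ?mem_index_enum.
by move=> s _; rewrite ltNge; apply/negP; exact: H.
Qed.

Lemma near_sup_seq (R : realType) (E : nat -> R) (M eta : R) :
  (forall m, E m <= M) -> 0 < eta -> exists m, forall m', E m' <= E m + eta.
Proof.
move=> EM eta0.
have hs : has_sup (range E).
  by split; [exists (E 0%N), 0%N|exists M => _ [m _ <-]; exact: EM].
have [_ [m _ <-] h] := sup_adherent eta0 hs.
exists m => m'; have : E m' <= sup (range E).
  by apply: sup_upper_bound => //; exists m'.
lra.
Qed.

Lemma continuous_sqr (R : realType) (w : R -> R) :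
  continuous w -> continuous (fun x => w x ^+ 2).
Proof. by move=> cw x; apply: cvgM; exact: cw. Qed.

(* The quotient at scale 1/m is an average of translates of the quotient v at
   scale 1/(mN); its squared norm being nearly the supremum over all scales,
   these translates cannot deviate much from their average. *)
Lemma dquo_near_translate (R : realType) (F : R -> R) (k v eta : R) :
  (forall x y, `|F x - F y| <= k * `|x - y|) ->
  (forall x, F (x + 1) = F x + v) -> 0 < eta ->
  exists2 m : nat, (0 < m)%N & forall N : nat, (0 < N)%N -> exists c : R,
    segint 0 1 (fun x => (dquo R F (m * N)%:R^-1 x - dquo R F m%:R^-1 (x + c)) ^+ 2)
    <= eta.
Proof.
move=> lF pF eta0.
have cF := ucont_continuous _ _ (lipschitz_ucont _ _ _ lF).
have cD h : continuous (dquo R F h) by exact: dquo_continuous.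
(* The index is shifted by one so that every scale is the inverse of a positive integer. The bound
   [k ^+ 2] on these energies provides a near-maximiser [m0]. *)
pose E m := segint 0 1 (fun x => dquo R F m.+1%:R^-1 x ^+ 2).
have EM m : E m <= k ^+ 2.
  have -> : k ^+ 2 = segint 0 1 (fun=> k ^+ 2) by rewrite segint_cst ?ler01 // subr0 mulr1.
  apply: segint_le; [exact: continuous_sqr|exact: cst_continuous|move=> x _].
  have := @dquo_bound R F k m.+1%:R^-1 x lF.
  rewrite invr_gt0 ltr0n => /(_ isT); rewrite ler_norml => /andP[]; nra.
have [m0 hm0] := near_sup_seq _ _ _ _ EM eta0.
exists m0.+1 => // N N0; set m := m0.+1; set h := (m * N)%:R^-1.
have mN0 : (0 < m * N)%N by rewrite muln_gt0.
have NR : N%:R != 0 :> R by rewrite pnatr_eq0 -lt0n.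
have hN : N%:R * h = m%:R^-1 :> R.
  by rewrite /h natrM invfM mulrCA mulfV // mulr1.
have avg x : \sum_(s < N) dquo R F h (x + s%:R * h) = N%:R * dquo R F m%:R^-1 x.
  rewrite dquo_avg hN /dquo /h invrK natrM invrK; ring.
pose a s x := (dquo R F m%:R^-1 x - dquo R F h (x + s%:R * h)) ^+ 2.
have ca s : continuous (a s).
  apply: continuous_sqr => x; apply: cvgB; first exact: cD.
  exact: continuous_shiftr.
(* The variance identity is integrated over a period. All translates of the fine quotient have the
   same energy, so the deviations add up to N times the gain in energy, at most N [eta] by the
   choice of [m0]; hence some translate deviates by at most [eta]. *)
have sE : \sum_(s < N) segint 0 1 (a s) = N%:R * (E (m * N).-1 - E m0).
  rewrite -segint_sum //.
  transitivity (segint 0 1 (fun x => \sum_(s < N) dquo R F h (x + s%:R * h) ^+ 2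
    - N%:R * dquo R F m%:R^-1 x ^+ 2)).
    congr Rintegral; apply/funext => x.
    by rewrite -(sum_sqr_dev _ (fun s => dquo R F h (x + s%:R * h)) N _ (avg x)).
  rewrite segint_B; last 2 first.
  - apply: (@continuous_sum R N (fun s x => dquo R F h (x + s%:R * h) ^+ 2)) => s.
    by apply: continuous_sqr; exact: continuous_shiftr.
  - move=> x; apply: cvgM; first exact: cvg_cst.
    exact: continuous_sqr.
  rewrite segint_Z; last exact: continuous_sqr.
  rewrite (@segint_sum R 0 1 N (fun s x => dquo R F h (x + s%:R * h) ^+ 2)); last first.
    by move=> s; apply: continuous_sqr; exact: continuous_shiftr.
  rewrite mulrBr; congr (_ - _).
  rewrite -[N in N%:R]card_ord mulr_natl -sumr_const; apply: eq_bigr => s _.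
  rewrite (@segint_periodic_shift R (s%:R * h) (fun x => dquo R F h x ^+ 2)).
  - by rewrite /E prednK.
  - exact: continuous_sqr.
  - by move=> x; rewrite (dquo_periodic _ _ _ _ _ pF).
have [s hs] : exists s, segint 0 1 (a s) <= eta.
  apply: (sum_le_exists _ _ N) => //; rewrite sE ler_wpM2l //.
  by have := hm0 (m * N).-1; lra.
(* Shifting the variable by - s h moves the translation from the fine quotient to the coarse one,
   without changing the integral over a period. *)
exists (- (s%:R * h)); apply: le_trans hs; rewrite le_eqVlt; apply/orP; left; apply/eqP.
rewrite -(@segint_periodic_shift R (- (s%:R * h)) (a s)) //; last first.
  move=> x; rewrite /a (dquo_periodic _ _ _ _ _ pF) addrAC.
  by rewrite (dquo_periodic _ _ _ _ _ pF).
congr Rintegral; apply/funext => x; rewrite /a subrK.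
by rewrite -sqrrN opprB.
Qed.

(** The squared error is taken at most e^2. Pointwise |u| <= u^2 / (2 e) + e / 2, and over the unit
    segment the right side integrates to at most e. *)
Lemma dquo_near_translate_L1 (R : realType) (F : R -> R) (k v e : R) :
  (forall x y, `|F x - F y| <= k * `|x - y|) ->
  (forall x, F (x + 1) = F x + v) -> 0 < e ->
  exists2 m : nat, (0 < m)%N & forall N : nat, (0 < N)%N -> exists c : R,
    segint 0 1 (fun x => `|dquo R F (m * N)%:R^-1 x - dquo R F m%:R^-1 (x + c)|) <= e.
Proof.
move=> lF pF e0; have cF := ucont_continuous _ _ (lipschitz_ucont _ _ _ lF).
have [m m0 H] := dquo_near_translate R F k v (e ^+ 2) lF pF (exprn_gt0 2 e0).
exists m => // N N0; have [c Hc] := H N N0; exists c.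
set u := fun x => dquo R F (m * N)%:R^-1 x - dquo R F m%:R^-1 (x + c).
have cu : continuous u.
  move=> x; apply: cvgB; first exact: dquo_continuous.
  by apply: (@continuous_shiftr R c (dquo R F m%:R^-1)); exact: dquo_continuous.
have cu2 : continuous (fun x => (2 * e)^-1 * u x ^+ 2).
  by move=> x; apply: cvgM; [exact: cvg_cst|exact: continuous_sqr].
apply: (@le_trans _ _ (segint 0 1 (fun x => (2 * e)^-1 * u x ^+ 2 + e / 2))).
  apply: segint_le; first exact: continuous_norm.
    by move=> x; apply: cvgD; [exact: cu2|exact: cvg_cst].
  move=> x _; rewrite -subr_ge0.
  have -> : (2 * e)^-1 * u x ^+ 2 + e / 2 - `|u x| = (2 * e)^-1 * (`|u x| - e) ^+ 2.
    by rewrite -(real_normK (num_real (u x))); field; lra.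
  by rewrite mulr_ge0 ?sqr_ge0 // invr_ge0; lra.
rewrite segint_D //; last exact: cst_continuous.
rewrite (@segint_Z R 0 1 (2 * e)^-1 (fun x => u x ^+ 2)); last exact: continuous_sqr.
rewrite segint_cst ?ler01 // subr0 mulr1.
have h : (2 * e)^-1 * segint 0 1 (fun x => u x ^+ 2) <= (2 * e)^-1 * e ^+ 2.
  by rewrite ler_wpM2l // invr_ge0; lra.
have E : (2 * e)^-1 * e ^+ 2 = e / 2 by field; lra.
by move: h; rewrite E; lra.
Qed.

(** * Birkhoff sums over an irrational rotation *)

Lemma mulr_natr_sum (R : realType) (c : R) n : c * n%:R = \sum_(i < n) c.
Proof. by rewrite sumr_const card_ord mulr_natr. Qed.

(** Dirichlet's pigeonhole: among the M + 1 fractional parts of i [alpha], 0 <= i <= M, two lie in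
    the same cell of length 1/M < [eta]. Their difference is nonzero, as otherwise [alpha] would be
    rational. *)
Lemma irrational_small_multiple (R : realType) (alpha eta : R) :
  (forall q : rat, alpha != ratr q) -> 0 < eta ->
  exists q : nat, exists p : int, 0 < `|q%:R * alpha - p%:~R| < eta.
Proof.
move=> irr eta0.
pose M := (Num.truncn eta^-1).+1.
have M0 : 0 < M%:R :> R by rewrite ltr0n.
have Meta : M%:R^-1 < eta.
  have h : eta^-1 < M%:R by exact: truncnS_gt.
  by rewrite -[ltRHS]invrK ltf_pV2 // posrE invr_gt0.
pose fr (i : nat) : R := i%:R * alpha - (Num.floor (i%:R * alpha))%:~R.
have fr0 i : 0 <= fr i < 1.
  have /andP[h1 h2] := floor_itv (i%:R * alpha).
  by move: h2; rewrite intrD1 /fr => h2; apply/andP; split; lra.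
pose g (i : nat) := Num.truncn (M%:R * fr i).
have Mfr i : 0 <= M%:R * fr i by rewrite mulr_ge0 //; case/andP: (fr0 i).
have gM i : (g i < M)%N.
  have /andP[h1 _] := truncn_itv (Mfr i).
  rewrite -(ltr_nat R); apply: le_lt_trans h1 _.
  by rewrite -[ltRHS]mulr1 ltr_pM2l //; case/andP: (fr0 i).
have [i [j [ij gij]]] : exists i j : nat, (i < j)%N /\ g i = g j.
  pose G (i : 'I_M.+1) : 'I_M := Ordinal (gM i).
  have /injectivePn[i [j nij Gij]] : ~~ injectiveb G.
    apply/negP => /injectiveP /leq_card; rewrite !card_ord.
    by rewrite ltnn.
  have gij : g i = g j by move/(congr1 val): Gij.
  case: (ltngtP i j) => h; [by exists i, j|by exists j, i|].
  by move/val_inj : h nij => ->; rewrite eqxx.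
exists (j - i)%N, (Num.floor (j%:R * alpha) - Num.floor (i%:R * alpha)).
have -> : (j - i)%:R * alpha - (Num.floor (j%:R * alpha) -
    Num.floor (i%:R * alpha))%:~R = fr j - fr i.
  by rewrite /fr natrB ?(ltnW ij) // rmorphB /=; ring.
apply/andP; split; last first.
  apply: lt_trans Meta.
  have /andP[h1 h2] := truncn_itv (Mfr i); have /andP[h3 h4] := truncn_itv (Mfr j).
  move: h1 h2 h3 h4; rewrite -!/(g _) gij -!(natr1 (g j)) => h1 h2 h3 h4.
  rewrite -(ltr_pM2l M0) mulfV ?gt_eqF // -{1}(gtr0_norm M0) -normrM.
  by rewrite mulrBr ltr_norml; apply/andP; split; lra.
rewrite normr_gt0; apply/eqP => E.
have ji0 : (j - i)%:R != 0 :> R by rewrite pnatr_eq0 subn_eq0 -ltnNge.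
have /eqP := irr ((Num.floor (j%:R * alpha) - Num.floor (i%:R * alpha))%:~R
  / (j - i)%:R).
apply; rewrite fmorph_div /= ratr_int ratr_nat.
apply/(mulIf ji0); rewrite mulfVK // rmorphB /= natrB ?(ltnW ij) //.
move: E; rewrite /fr; set a := (Num.floor _)%:~R; set b := (Num.floor _)%:~R.
by move=> E; lra.
Qed.

(** A small nonzero b = q [alpha] - p makes every q-th orbit point advance by b modulo 1. The
    distance to cover is at most 1 modulo integers, so 1/|b| such steps suffice, and [N] depends on
    neither [x] nor [y]. *)
Lemma irrational_orbit_dense (R : realType) (alpha eta : R) :
  (forall q : rat, alpha != ratr q) -> 0 < eta ->
  exists N : nat, forall x y : R, exists2 j : nat, (j <= N)%N &
    exists z : int, `|x + j%:R * alpha + z%:~R - y| < eta.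
Proof.
move=> irr eta0.
have [q [p]] := irrational_small_multiple R alpha eta irr eta0.
set b := _ - _ => /andP[b0 beta].
exists (q * Num.truncn `|b|^-1)%N => x y.
have bn0 : b != 0 by rewrite -normr_gt0.
(* The integer [z] is chosen so that the remaining displacement y - x - z has the sign of [b]:
   rounding is upwards when [b] is negative. *)
have [z /andP[tz0 tz1]] : exists z : int, 0 <= (y - x - z%:~R) / b <= `|b|^-1.
  have /andP[h1 h2] := floor_itv (y - x); move: h2; rewrite intrD1 => h2.
  move: b0; rewrite normr_gt0 neq_lt => /orP[bneg|bpos].
    exists (Num.floor (y - x) + 1); rewrite ltr0_norm // intrD1 invrN.
    have bi : b^-1 < 0 by rewrite invr_lt0.
    by apply/andP; split; nra.
  exists (Num.floor (y - x)); rewrite gtr0_norm //.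
  have bi : 0 < b^-1 by rewrite invr_gt0.
  by apply/andP; split; nra.
set s := Num.truncn ((y - x - z%:~R) / b).
have /andP[s1 s2] := truncn_itv tz0; rewrite -/s -natr1 in s1 s2.
exists (q * s)%N.
  rewrite leq_mul2l; apply/orP; right; exact: le_truncn.
exists (z - p *+ s).
have -> : x + (q * s)%:R * alpha + (z - p *+ s)%:~R - y
    = - b * ((y - x - z%:~R) / b - s%:R).
  rewrite rmorphB rmorphMn /= natrM -mulr_natr mulrBr mulNr mulrCA mulfV // /b; ring.
apply: le_lt_trans beta; rewrite normrM normrN -[leRHS]mulr1 ler_wpM2l //.
by rewrite ler_norml; apply/andP; split; lra.
Qed.

(** Advancing the starting point by one rotation drops the first term of the sum and adds a new last
    one, at a cost of at most 2 C. *)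
Lemma orbit_sum_shift (R : realType) (alpha C : R) (p : R -> R) n j x :
  (forall x, `|p x| <= C) ->
  `|\sum_(i < n) p (x + j%:R * alpha + i%:R * alpha)
    - \sum_(i < n) p (x + i%:R * alpha)| <= 2 * j%:R * C.
Proof.
move=> pC; elim: j => [|j IH].
  by rewrite mul0r addr0 subrr normr0 mulr0 mul0r.
set A := fun y => \sum_(i < n) p (y + i%:R * alpha).
have stepA y : A (y + alpha) - A y = p (y + n%:R * alpha) - p y.
  rewrite /A; elim: n {IH A} => [|n IH].
    by rewrite !big_ord0 mul0r addr0 !subrr.
  rewrite !big_ord_recr /=.
  have -> : y + alpha + n%:R * alpha = y + n.+1%:R * alpha by rewrite -natr1; ring.
  by move: IH; set a := \sum_(_ < _) _; set b := \sum_(_ < _) _; lra.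
have := stepA (x + j%:R * alpha).
have -> : x + j%:R * alpha + alpha = x + j.+1%:R * alpha by rewrite -natr1; ring.
have h1 := pC (x + j%:R * alpha + n%:R * alpha); have h2 := pC (x + j%:R * alpha).
rewrite -/(A (x + j%:R * alpha)) -/(A x) in IH *; rewrite -/(A (x + j.+1%:R * alpha)).
move: IH h1 h2; rewrite !ler_norml -natr1.
by move=> /andP[? ?] /andP[? ?] /andP[? ?] ?; apply/andP; split; lra.
Qed.

(** At most [N] rotations bring [x] close to [y] modulo 1, at a bounded cost 2 N C that a large [n]
    absorbs. From there the two orbits stay equally close, and the sums are compared term by
    term. *)
Lemma orbit_sum_oscillation (R : realType) (alpha C L e : R) (p : R -> R) :
  (forall q : rat, alpha != ratr q) ->
  (forall x y, `|p x - p y| <= L * `|x - y|) -> (forall x, `|p x| <= C) ->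
  (forall x, p (x + 1) = p x) -> 0 < e ->
  exists N0 : nat, forall n, (N0 <= n)%N -> forall x y,
    `|\sum_(i < n) p (x + i%:R * alpha) - \sum_(i < n) p (y + i%:R * alpha)|
    <= e * n%:R.
Proof.
move=> irr lp pC pp e0.
have [r r0 ur] := lipschitz_ucont R L p lp (e / 2) (divr_gt0 e0 (ltr0Sn _ 1)).
have [N HN] := irrational_orbit_dense R alpha r irr r0.
pose N0 := (Num.truncn (`|2 * N%:R * C| / (e / 2))).+1.
exists N0 => n N0n x y; have [j jN [z hz]] := HN x y.
have C0 : 0 <= C by apply: le_trans (pC 0).
have nbig : 2 * N%:R * C <= e / 2 * n%:R.
  rewrite [leRHS]mulrC -ler_pdivrMr ?divr_gt0 //.
  apply: (@le_trans _ _ (`|2 * N%:R * C| / (e / 2))).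
    by rewrite ler_wpM2r ?ler_norm // invr_ge0; lra.
  apply: (@le_trans _ _ N0%:R); last by rewrite ler_nat.
  by apply/ltW; apply: truncnS_gt.
have h1 := orbit_sum_shift R alpha C p n j x pC.
have h2 : `|\sum_(i < n) p (x + j%:R * alpha + i%:R * alpha)
    - \sum_(i < n) p (y + i%:R * alpha)| <= e / 2 * n%:R.
  rewrite -sumrB; apply: le_trans (ler_norm_sum _ _ _) _.
  rewrite mulr_natr_sum; apply: ler_sum => i _.
  have <- : p (x + j%:R * alpha + i%:R * alpha + z%:~R)
      = p (x + j%:R * alpha + i%:R * alpha).
    by rewrite (@periodic_int R R p 0) ?mul0rz ?addr0 // => u; rewrite addr0.
  apply: ur; rewrite (_ : _ - _ = x + j%:R * alpha + z%:~R - y) //; ring.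
have h3 : 2 * j%:R * C <= 2 * N%:R * C.
  by rewrite ler_wpM2r // ler_wpM2l // ler_nat.
move: h1 h2; rewrite !ler_norml => /andP[? ?] /andP[? ?]; apply/andP; split; lra.
Qed.

(** Over the [m] equally spaced points x + r/m the quotients telescope to a full period of [F], so
    the Birkhoff sums at these points have mean exactly n v. Their small oscillation puts each of
    them close to that mean. *)
Lemma dquo_orbit_sum (R : realType) (alpha k v e : R) (F : R -> R) (m : nat) :
  (forall q : rat, alpha != ratr q) ->
  (forall x y, `|F x - F y| <= k * `|x - y|) ->
  (forall x, F (x + 1) = F x + v) -> (0 < m)%N -> 0 < e ->
  exists N0 : nat, forall n, (N0 <= n)%N -> forall x,
    `|\sum_(i < n) dquo R F m%:R^-1 (x + i%:R * alpha) - n%:R * v| <= e * n%:R.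
Proof.
move=> irr lF pF m0 e0; set h := m%:R^-1; set p := dquo R F h.
have mR : 0 < m%:R :> R by rewrite ltr0n.
have h0 : 0 < h by rewrite invr_gt0.
(* This Lipschitz constant grows with [m], which is harmless because [m] is fixed before [n]. *)
have lp x y : `|p x - p y| <= (2 * k * m%:R) * `|x - y|.
  have -> : p x - p y = ((F (x + h) - F (y + h)) - (F x - F y)) * m%:R.
    by rewrite /p /dquo /h invrK; ring.
  rewrite normrM (gtr0_norm mR) -mulrA [m%:R * _]mulrC mulrA ler_pM2r //.
  apply: le_trans (ler_normB _ _) _.
  have := lF (x + h) (y + h); have := lF x y.
  by rewrite (_ : x + h - (y + h) = x - y); [lra|ring].
have [N0 HN0] := orbit_sum_oscillation R alpha k _ e p irr lp
  (fun x => dquo_bound R F k h x lF h0) (fun x => dquo_periodic R F h v x pF) e0.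
exists N0 => n nN0 x; set A := fun x => \sum_(i < n) p (x + i%:R * alpha).
have mean : \sum_(r < m) A (x + r%:R * h) = m%:R * (n%:R * v).
  rewrite /A exchange_big /=.
  rewrite (eq_bigr (fun=> m%:R * v)); last first.
    move=> i _; under eq_bigr do rewrite addrAC.
    rewrite dquo_avg mulfV ?gt_eqF // pF /h invrK; ring.
  by rewrite sumr_const card_ord -mulr_natl; ring.
rewrite -/(A x) -(ler_pM2l mR) -[X in X * `|_|](gtr0_norm mR) -normrM.
rewrite mulrBr -mean [m%:R * A x]mulrC (mulr_natr_sum R (A x) m) -sumrB.
apply: le_trans (ler_norm_sum _ _ _) _.
rewrite [leRHS]mulrC (mulr_natr_sum R _ m); apply: ler_sum => r _.
exact: HN0.
Qed.

(** * Weak convergence to zero along Birkhoff sums *)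

Definition orbit_sum (R : realType) (alpha : R) (F : R -> R) (n : nat) (x : R) :=
  \sum_(i < n) F (x + i%:R * alpha).

Lemma orbit_sum_lipschitz (R : realType) (alpha k : R) (F : R -> R) n x y :
  (forall x y, `|F x - F y| <= k * `|x - y|) ->
  `|orbit_sum R alpha F n x - orbit_sum R alpha F n y| <= n%:R * k * `|x - y|.
Proof.
move=> lF; rewrite /orbit_sum -sumrB; apply: le_trans (ler_norm_sum _ _ _) _.
rewrite [leRHS](_ : _ = k * `|x - y| * n%:R); last by ring.
rewrite (mulr_natr_sum R _ n); apply: ler_sum => i _.
apply: le_trans (lF _ _) _.
by rewrite (_ : x + i%:R * alpha - (y + i%:R * alpha) = x - y) //; ring.
Qed.

Lemma segint_ge0 (R : realType) (a b : R) (w : R -> R) :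
  (forall x, 0 <= w x) -> 0 <= segint a b w.
Proof. by move=> w0; apply: Rintegral_ge0. Qed.

Lemma segint_subitv (R : realType) (a b c d : R) (w : R -> R) :
  continuous w -> (forall x, 0 <= w x) -> c <= a -> a <= b -> b <= d ->
  segint a b w <= segint c d w.
Proof.
move=> cw w0 ca ab bd.
rewrite -(segint_chasles R c a d) ?(le_trans ab) // -(segint_chasles R a b d) //.
by have := segint_ge0 R c a w w0; have := segint_ge0 R b d w w0; lra.
Qed.

Lemma continuous_primitive (R : realType) (w : R -> R) : continuous w ->
  exists P : R -> R, P 0 = 0 /\ forall x y, x <= y -> P y - P x = segint x y w.
Proof.
(* A segment with reversed bounds is empty and its integral is 0, not the opposite of the integral;
   the sign is therefore put in by hand on the negative side. *)
move=> cw; exists (fun y => if 0 <= y then segint 0 y w else - segint y 0 w).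
have J00 : segint 0 0 w = 0 by rewrite set_itv1 Rintegral_set1.
split; first by rewrite lexx.
move=> x y xy; case: ifPn; case: ifPn => x0 y0.
- by rewrite -(segint_chasles R 0 x y) // addrAC subrr add0r.
- rewrite -ltNge in x0.
  by rewrite -(segint_chasles R x 0 y) ?(ltW x0) //; ring.
- by have := le_trans x0 xy; rewrite (negbTE y0).
- rewrite -ltNge in y0; rewrite -(segint_chasles R x y 0) ?(ltW y0) //; ring.
Qed.

Lemma real_mod1 (R : realType) (y : R) :
  exists r : R, [/\ 0 <= r, r < 1 & exists z : int, y = r + z%:~R].
Proof.
exists (y - (Num.floor y)%:~R); have /andP[h1 h2] := floor_itv y.
move: h2; rewrite intrD1 => h2.
by split; [lra|lra|exists (Num.floor y); rewrite subrK].
Qed.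

(** Mean zero makes the primitive 1-periodic; as it vanishes at 0, it is bounded by the integral of
    |w| over part of one period. *)
Lemma periodic_primitive (R : realType) (M : R) (w : R -> R) : continuous w ->
  (forall x, w (x + 1) = w x) -> segint 0 1 w = 0 -> (forall x, `|w x| <= M) ->
  exists P : R -> R, (forall x y, x <= y -> P y - P x = segint x y w) /\
    forall y, `|P y| <= M.
Proof.
move=> cw pw w0 wM; have [P [P0 PJ]] := continuous_primitive R w cw.
exists P; split => // y; have [r [r0 r1 [z ->]]] := real_mod1 R y.
have M0 : 0 <= M by apply: le_trans (wM 0).
rewrite (@periodic_int R R P 0) ?mul0rz ?addr0; last first.
  move=> x; rewrite addr0; apply/eqP; rewrite -subr_eq0 PJ ?lerDl ?ler01 //.
  have := segint_periodic_shift R x w cw pw.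
  by rewrite segint_shift ?ler01 // add0r (addrC 1) w0 => ->.
rewrite -[P r]subr0 -[X in _ - X]P0 PJ //.
apply: le_trans (segint_bound R 0 r M w cw r0 (fun x _ => wM x)) _.
by rewrite subr0 -[leRHS]mulr1 ler_wpM2l // ltW.
Qed.

Lemma primitive_first_order (R : realType) (e r : R) (w P : R -> R) :
  continuous w -> (forall x y, x <= y -> P y - P x = segint x y w) ->
  (forall x y, `|x - y| < r -> `|w x - w y| <= e) ->
  forall x y, `|y - x| < r -> `|P y - P x - (y - x) * w x| <= e * `|y - x|.
Proof.
move=> cw PJ ew x y yx.
have cst_c : continuous (fun _ : R => w x) by exact: cst_continuous.
have cB : continuous (fun t => w t - w x) by move=> t; apply: cvgB; [exact: cw|exact: cvg_cst].
have [xy|/ltW xy] := leP x y.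
  have -> : P y - P x - (y - x) * w x = segint x y (fun t => w t - w x).
    by rewrite segint_B // segint_cst // PJ //; ring.
  move: yx; rewrite ger0_norm ?subr_ge0 // => yx.
  apply: segint_bound => // t /andP[xt ty]; apply: ew.
  by rewrite ger0_norm; lra.
have -> : P y - P x - (y - x) * w x = - segint y x (fun t => w t - w x).
  by rewrite segint_B // segint_cst // -PJ //; ring.
move: yx; rewrite normrN distrC ger0_norm ?subr_ge0 // => yx.
apply: segint_bound => // t /andP[xt ty]; apply: ew.
by rewrite distrC ger0_norm; lra.
Qed.

(** The two integrals of [g] cancel except over [b, b + h] and [a, a + h], each contributing at most
    M h. *)
Lemma segint_increment_bound (R : realType) (a b h M : R) (g : R -> R) :
  continuous g -> a <= b -> 0 <= h -> (forall x, `|g x| <= M) ->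
  `|segint a b (fun x => g (x + h) - g x)| <= 2 * M * h.
Proof.
move=> cg ab h0 gM; rewrite segint_B //; last exact: continuous_shiftr.
rewrite segint_shift //.
have : segint a b g + segint b (b + h) g = segint a (a + h) g + segint (a + h) (b + h) g.
  by rewrite !segint_chasles //; lra.
have := segint_bound R a (a + h) M g cg _ (fun x _ => gM x).
have := segint_bound R b (b + h) M g cg _ (fun x _ => gM x).
rewrite !lerDl h0 => /(_ isT) + /(_ isT).
rewrite !ler_norml => /andP[? ?] /andP[? ?] ?; apply/andP; split; lra.
Qed.

Lemma continuous_comp2 (R : realType) (f g : R -> R) :
  continuous f -> continuous g -> continuous (fun x => g (f x)).
Proof. by move=> cf cg x; apply: (@continuous_comp _ _ _ f g); [exact: cf|exact: cg]. Qed.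

Lemma continuous_mulr (R : realType) (f g : R -> R) :
  continuous f -> continuous g -> continuous (fun x => f x * g x).
Proof. by move=> cf cg x; apply: cvgM; [exact: cf|exact: cg]. Qed.

Lemma continuous_subr (R : realType) (f g : R -> R) :
  continuous f -> continuous g -> continuous (fun x => f x - g x).
Proof. by move=> cf cg x; apply: cvgB; [exact: cf|exact: cg]. Qed.

Lemma continuous_addr (R : realType) (f g : R -> R) :
  continuous f -> continuous g -> continuous (fun x => f x + g x).
Proof. by move=> cf cg x; apply: cvgD; [exact: cf|exact: cg]. Qed.

(* For [P' = w], the increments of [P \o U] over steps of length h integrate to
   O(h), while to first order they equal [w (U x) * (U (x + h) - U x)]. *)
Lemma segint_dquo_comp (R : realType) (a b h M k e r : R) (w U : R -> R) :
  continuous w -> (forall x, w (x + 1) = w x) -> segint 0 1 w = 0 ->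
  (forall x, `|w x| <= M) ->
  (forall x y, `|x - y| < r -> `|w x - w y| <= e) -> 0 <= e ->
  (forall x y, `|U x - U y| <= k * `|x - y|) ->
  0 <= a -> a <= b -> b <= 1 -> 0 < h -> k * h < r ->
  `|segint a b (fun x => dquo R U h x * w (U x))| <= 2 * M + e * k.
Proof.
move=> cw pw w0 wM ew e0 lU a0 ab b1 h0 kh.
have cU := ucont_continuous _ _ (lipschitz_ucont _ _ _ lU).
have [P [PJ PM]] := periodic_primitive R M w cw pw w0 wM.
have lP x y : `|P x - P y| <= M * `|x - y|.
  wlog xy : x y / x <= y.
    move=> H; have [/H//|/ltW/H] := leP x y.
    by rewrite distrC (distrC y).
  rewrite distrC (distrC x) PJ // (@ger0_norm _ (y - x)) ?subr_ge0 //.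
  exact: segint_bound.
have cP := ucont_continuous _ _ (lipschitz_ucont _ _ _ lP).
pose g x := P (U x).
have cg : continuous g by exact: continuous_comp2.
have cwU : continuous (fun x => w (U x)) by exact: continuous_comp2.
have cD : continuous (fun x => dquo R U h x * w (U x)).
  by apply: continuous_mulr => //; exact: dquo_continuous.
have cI : continuous (fun x => g (x + h) - g x).
  by apply: continuous_subr => //; exact: continuous_shiftr.
have h1 := segint_increment_bound R a b h M g cg ab (ltW h0) (fun x => PM _).
have chD : continuous (fun x => h * (dquo R U h x * w (U x))).
  by apply: continuous_mulr => //; exact: cst_continuous.
have h2 : `|segint a b (fun x => (g (x + h) - g x) - h * (dquo R U h x * w (U x)))|
    <= e * k * h * (b - a).
  apply: segint_bound => //; first exact: continuous_subr.
  move=> x _.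
  have Uh : `|U (x + h) - U x| <= k * h.
    by apply: le_trans (lU _ _) _; rewrite addrAC subrr add0r gtr0_norm.
  have -> : h * (dquo R U h x * w (U x)) = (U (x + h) - U x) * w (U x).
    by rewrite /dquo; field; rewrite gt_eqF.
  apply: le_trans (primitive_first_order R e r w P cw PJ ew _ _ _) _.
    exact: le_lt_trans kh.
  by rewrite -mulrA ler_wpM2l.
have k0 : 0 <= k by have := lU 0 1; rewrite sub0r normrN normr1 mulr1; exact: le_trans.
move: h2; rewrite segint_B // (@segint_Z R a b h (fun x => dquo R U h x * w (U x))) // => h2.
(* Both the increment bound and the first-order error carry a factor [h], which cancels. *)
rewrite -(ler_pM2l h0) -{1}(gtr0_norm h0) -normrM.
have ekh : 0 <= e * k * h by rewrite mulr_ge0 ?mulr_ge0 // ltW.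
have h3 : e * k * h * (b - a) <= e * k * h by rewrite -[leRHS]mulr1 ler_wpM2l //; lra.
move: h1 h2; rewrite !ler_norml => /andP[? ?] /andP[? ?]; apply/andP; split; lra.
Qed.

(** The rank [N0] is chosen before [a], [b] and [w]. The modulus of continuity of [w] only affects
    the fine scale 1/(mN), and [N] may be chosen after [n] since the L^1 estimate on quotients holds
    for all [N]. *)
Lemma orbit_sum_weak_decay (R : realType) (alpha k M e : R) (F : R -> R) (d : int) :
  (forall q : rat, alpha != ratr q) ->
  (forall x y, `|F x - F y| <= k * `|x - y|) ->
  (forall x, F (x + 1) = F x + d%:~R) -> d != 0 -> 0 <= M -> 0 < e ->
  exists N0 : nat, forall n, (N0 <= n)%N -> forall (a b : R) (w : R -> R),
    0 <= a -> a <= b -> b <= 1 ->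
    ucont R w -> (forall x, w (x + 1) = w x) -> segint 0 1 w = 0 ->
    (forall x, `|w x| <= M) ->
    `|segint a b (fun x => w (orbit_sum R alpha F n x))| <= e.
Proof.
move=> irr lF pF d0 M0 e0; set v : R := d%:~R.
(* The nonzero degree enters here: the final estimate is divided by n |v| >= n. *)
have v1 : 1 <= `|v| by rewrite /v -intr_norm -[1]/(1%:~R) ler_int -gtz0_ge1 normr_gt0.
have cF := ucont_continuous _ _ (lipschitz_ucont _ _ _ lF).
have k0 : 0 <= k by have := lF 0 1; rewrite sub0r normrN normr1 mulr1; exact: le_trans.
(* The total error allowed is n e: a quarter for 2 M, a quarter for the oscillation of [w] (through
   [ew]), and a half for 2 M [e1] n, the error in replacing the quotient of the orbit sum by n v. *)
pose e1 := e / (4 * (M + 1)).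
have e10 : 0 < e1 by rewrite divr_gt0 //; lra.
have Me1 : M * e1 <= e / 4.
  rewrite /e1 mulrA ler_pdivrMr; last lra.
  by rewrite (_ : e / 4 * (4 * (M + 1)) = e * M + e); [lra|field].
have [m m0 Hm] := dquo_near_translate_L1 R F k v e1 lF pF e10.
have [N1 HN1] := dquo_orbit_sum R alpha k v e1 F m irr lF pF m0 e10.
exists (maxn N1 (Num.truncn (2 * M / (e / 4))).+1) => n.
rewrite geq_max => /andP[nN1 nN2] a b w a0 ab b1 uw pw w0 wM.
have cw := ucont_continuous _ _ uw.
have n0 : 0 < n%:R :> R by rewrite ltr0n; apply: leq_ltn_trans nN2.
have Mn : 2 * M <= e / 4 * n%:R.
  rewrite [leRHS]mulrC -ler_pdivrMr ?divr_gt0 //; apply/ltW.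
  apply: lt_le_trans (truncnS_gt _) _; by rewrite ler_nat.
pose ew := e / (4 * (k + 1)).
have ew0 : 0 < ew by rewrite divr_gt0 //; lra.
have ewk : ew * k <= e / 4.
  rewrite /ew mulrAC ler_pdivrMr; last lra.
  by rewrite (_ : e / 4 * (4 * (k + 1)) = e * k + e); [lra|field].
have [r r0 hr] := uw ew ew0.
set U := orbit_sum R alpha F n.
have lU x y : `|U x - U y| <= n%:R * k * `|x - y| by exact: orbit_sum_lipschitz.
have cU := ucont_continuous _ _ (lipschitz_ucont _ _ _ lU).
(* With this [N], one step h = 1/(mN) moves [U] by less than [r], the radius at which [w] varies by
   at most [ew]. *)
pose N := (Num.truncn (n%:R * k / r)).+1.
have [c Hc] := Hm N isT; set h := (m * N)%:R^-1 in Hc; set p := dquo R F m%:R^-1 in Hc.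
have mN0 : 0 < (m * N)%:R :> R by rewrite ltr0n muln_gt0 m0.
have h0 : 0 < h by rewrite invr_gt0.
have kh : n%:R * k * h < r.
  rewrite /h ltr_pdivrMr // [r * _]mulrC -ltr_pdivrMr //.
  apply: lt_le_trans (truncnS_gt _) _; rewrite ler_nat -/N leq_pmull //.
have h1 := segint_dquo_comp R a b h M (n%:R * k) ew r w U cw pw w0 wM hr (ltW ew0) lU
  a0 ab b1 h0 kh.
pose q x := `|dquo R F h x - p (x + c)|.
have cq : continuous q.
  apply: continuous_norm; apply: continuous_subr; first exact: dquo_continuous.
  by apply: continuous_shiftr; exact: dquo_continuous.
have qp x : q (x + 1) = q x.
  by rewrite /q addrAC /p !(dquo_periodic _ _ _ _ _ pF).
pose W x := \sum_(i < n) q (x + i%:R * alpha).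
have cqi i : continuous (fun x => q (x + i%:R * alpha)) by exact: continuous_shiftr.
have cW : continuous W by exact: (@continuous_sum R n (fun i x => q (x + i%:R * alpha))).
have W0 x : 0 <= W x by apply: sumr_ge0 => i _; exact: normr_ge0.
(* [W] is nonnegative, so the segment may be enlarged to a full period, where all translates of [q]
   have the same integral. *)
have JW : segint a b W <= e1 * n%:R.
  apply: le_trans (segint_subitv R a b 0 1 W cW W0 a0 ab b1) _.
  rewrite /W (@segint_sum R 0 1 n (fun i x => q (x + i%:R * alpha))) //.
  rewrite (mulr_natr_sum R _ n); apply: ler_sum => i _.
  by rewrite (@segint_periodic_shift R (i%:R * alpha) q).
have cwU : continuous (fun x => w (U x)) by exact: continuous_comp2.
have cD : continuous (dquo R U h) by exact: dquo_continuous.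
have cDw : continuous (fun x => dquo R U h x * w (U x)) by exact: continuous_mulr.
have dU x : dquo R U h x = \sum_(i < n) dquo R F h (x + i%:R * alpha).
  rewrite /dquo -mulr_suml; congr (_ / _); rewrite /U /orbit_sum -sumrB.
  by apply: eq_bigr => i _; rewrite addrAC.
have h2 : `|segint a b (fun x => (n%:R * v - dquo R U h x) * w (U x))|
    <= M * (e1 * n%:R + e1 * n%:R).
  have cvD : continuous (fun x => (n%:R * v - dquo R U h x) * w (U x)).
    by apply: continuous_mulr => //; apply: continuous_subr => //; exact: cst_continuous.
  have cWe : continuous (fun x => W x + e1 * n%:R).
    by apply: continuous_addr => //; exact: cst_continuous.
  apply: le_trans (segint_norm _ _ _ _ cvD) _.
  apply: (@le_trans _ _ (segint a b (fun x => M * (W x + e1 * n%:R)))).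
    apply: segint_le; first exact: continuous_norm.
      by apply: continuous_mulr => //; exact: cst_continuous.
    move=> x _; rewrite normrM mulrC; apply: ler_pM => //.
    (* The first part is the Birkhoff deviation of the translated coarse quotient, uniformly at most
       [e1] n; the second is the error between the two scales, at most [W x]. *)
    have -> : n%:R * v - dquo R U h x =
      - (\sum_(i < n) p (x + c + i%:R * alpha) - n%:R * v)
      - \sum_(i < n) (dquo R F h (x + i%:R * alpha) - p (x + i%:R * alpha + c)).
      rewrite sumrB -dU; under [X in _ - (_ - X)]eq_bigr do rewrite addrAC.
      by ring.
    apply: le_trans (ler_normB _ _) _; rewrite normrN addrC; apply: lerD.
      exact: ler_norm_sum.
    exact: HN1.
  rewrite segint_Z // segint_D //; last exact: cst_continuous.
  rewrite segint_cst // ler_wpM2l // lerD // -[leRHS]mulr1 ler_wpM2l //; last lra.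
  by rewrite mulr_ge0 // ltW.
have E : segint a b (fun x => (n%:R * v - dquo R U h x) * w (U x)) =
    n%:R * v * segint a b (fun x => w (U x)) - segint a b (fun x => dquo R U h x * w (U x)).
  rewrite -segint_Z // -segint_B //; last by apply: continuous_mulr => //; exact: cst_continuous.
  by congr Rintegral; apply/funext => x; rewrite mulrBl.
rewrite E in h2; move: h1 h2.
set I1 := segint a b (fun x => w (U x)); set I2 := segint a b _ => h1 h2.
have h3 : `|n%:R * v * I1| <= n%:R * e.
  have -> : n%:R * v * I1 = (n%:R * v * I1 - I2) + I2 by ring.
  apply: le_trans (ler_normD _ _) _; nra.
move: h3; rewrite !normrM (gtr0_norm n0) -mulrA ler_pM2l //.
by apply: le_trans; rewrite -[leLHS]mul1r ler_wpM2r.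
Qed.

(** * Periodic functions of two variables *)

(** Only [x] is confined to [K]; [y] may leave it. This is what is needed near the boundary of a
    fundamental domain. *)
Lemma compact_unif_continuous (R : realType) (X : pseudoMetricType R) (K : set X)
  (f : X -> R) (e : R) : compact K -> continuous f -> 0 < e ->
  exists2 r : R, 0 < r & forall x y, K x -> ball x r y -> `|f x - f y| <= e.
Proof.
move=> /compact_near_coveringP cK cf e0.
(* The radius is a parameter tending to 0 from the right, so compactness in its near-covering form
   yields one radius for all of [K]. *)
have := cK R (0^'+) (fun r x => forall y, ball x r y -> `|f x - f y| <= e) _.
case.
  move=> x Kx.
  have /cvgrPdist_lt/(_ (e / 2)) := cf x.
  rewrite divr_gt0 // => /(_ isT) /nbhs_ballP[s /= s0 hs].
  exists (ball x (s / 2), [set r : R | r < s / 2]) => /=.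
    split; first by apply: nbhsx_ballx; rewrite divr_gt0.
    by near=> t; near: t; apply: nbhs_right_lt; rewrite divr_gt0.
  move=> [z r] /= [xz rs] y zy.
  have h1 := hs z (le_ball (_ : s / 2 <= s) xz).
  have h2 : ball x s y.
    rewrite [s]splitr; apply: ball_triangle xz _.
    by apply: le_ball zy; exact: ltW.
  move: (hs y h2) (h1 ltac:(lra)); rewrite !ltr_norml ler_norml.
  by move=> /andP[? ?] /andP[? ?]; apply/andP; split; lra.
move=> /= r r0 hr; exists (r / 2); first by rewrite divr_gt0.
move=> x y Kx xy; apply: (hr (r / 2)) => //.
  by rewrite /ball_ /= sub0r normrN gtr0_norm ?divr_gt0 //; lra.
by rewrite divr_gt0.
Unshelve. all: by end_near. Qed.

Lemma compact_norm_bound (R : realType) (X : topologicalType) (K : set X)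
  (f : X -> R) : compact K -> continuous f ->
  exists2 M : R, 0 <= M & forall x, K x -> `|f x| <= M.
Proof.
move=> cK cf.
have [M [_ HM]] : bounded_set (f @` K).
  apply: compact_bounded; apply: continuous_compact => //.
  exact: continuous_subspaceT.
exists (`|M| + 1); first by rewrite addr_ge0.
move=> x Kx; apply: (HM (`|M| + 1)); last by exists x.
by rewrite (le_lt_trans (ler_norm M)) // ltrDl.
Qed.

Definition periodic2 (R : realType) (phi : R * R -> R) := forall x y : R,
  phi (x + 1, y) = phi (x, y) /\ phi (x, y + 1) = phi (x, y).

Definition ucont2 (R : realType) (phi : R * R -> R) := forall e : R, 0 < e ->
  exists2 r : R, 0 < r & forall x y x' y',
    `|x - x'| < r -> `|y - y'| < r -> `|phi (x, y) - phi (x', y')| <= e.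

Lemma periodic2_int (R : realType) (phi : R * R -> R) (x y : R) (i j : int) :
  periodic2 R phi -> phi (x + i%:~R, y + j%:~R) = phi (x, y).
Proof.
move=> pphi.
rewrite (@periodic_int R R (fun u => phi (u, y + j%:~R)) 0); last first.
  by move=> u; rewrite addr0; exact: (pphi _ _).1.
rewrite mul0rz addr0 (@periodic_int R R (fun u => phi (x, u)) 0) ?mul0rz ?addr0 //.
by move=> u; rewrite addr0; exact: (pphi _ _).2.
Qed.

Lemma compact_unit_square_closure (R : realType) :
  compact (`[0, 1]%classic `*` `[0, 1]%classic : set (R * R)).
Proof. by apply: compact_setX; exact: segment_compact. Qed.

(** The first point is brought into the unit square and the second is translated by the same
    integers, which preserves their distance. *)
Lemma periodic2_ucont (R : realType) (phi : R * R -> R) :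
  continuous phi -> periodic2 R phi -> ucont2 R phi.
Proof.
move=> cphi pphi e e0.
have [r r0 H] := compact_unif_continuous R _ _ phi e
  (compact_unit_square_closure R) cphi e0.
exists r => // x y x' y'.
have [s [s0 s1 [i ->]]] := real_mod1 R x; have [t [t0 t1 [j ->]]] := real_mod1 R y.
move=> hx hy; rewrite periodic2_int // -(@periodic2_int R phi x' y' (- i) (- j)) //.
apply: H => /=; first by rewrite !in_itv /= s0 t0 !ltW.
by split => /=; rewrite /ball /= mulrNz opprD opprK addrA addrAC.
Qed.

Lemma periodic2_bound (R : realType) (phi : R * R -> R) :
  continuous phi -> periodic2 R phi ->
  exists2 M : R, 0 <= M & forall z, `|phi z| <= M.
Proof.
move=> cphi pphi.
have [M M0 H] := compact_norm_bound R _ _ phi (compact_unit_square_closure R) cphi.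
exists M => // -[x y].
have [s [s0 s1 [i ->]]] := real_mod1 R x; have [t [t0 t1 [j ->]]] := real_mod1 R y.
by rewrite periodic2_int //; apply: H; rewrite /= !in_itv /= s0 t0 !ltW.
Qed.

Lemma ucont2_comp (R : realType) (phi : R * R -> R) (f g : R -> R) :
  ucont2 R phi -> continuous f -> continuous g ->
  continuous (fun x => phi (f x, g x)).
Proof.
move=> uphi cf cg x; apply/cvgrPdist_le => e e0; have [r r0 H] := uphi e e0.
near=> y; apply: H; near: y.
  by apply: cvgr_dist_lt => //; exact: cf.
by apply: cvgr_dist_lt => //; exact: cg.
Unshelve. all: by end_near. Qed.

Lemma ucont2_section (R : realType) (phi : R * R -> R) (x c : R) :
  ucont2 R phi -> ucont R (fun y => phi (x, c + y)).
Proof.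
move=> uphi e e0; have [r r0 H] := uphi e e0; exists r => // y y' yy'.
by apply: H; rewrite ?subrr ?normr0 // opprD addrACA subrr add0r.
Qed.

(** Measurability is meant for the product sigma-algebra. Rounding the first variable down to
    multiples of 1/(k + 1) gives functions whose preimages are countable unions of measurable
    rectangles and which converge pointwise to [phi]. *)
Lemma ucont2_measurable (R : realType) (phi : R * R -> R) :
  ucont2 R phi -> measurable_fun [set: R * R] phi.
Proof.
move=> uphi.
have cid : continuous (fun y : R => y) by move=> y; exact: cvg_id.
pose g (k : nat) (z : R * R) : R :=
  phi ((Num.floor (k.+1%:R * z.1))%:~R / k.+1%:R, z.2).
apply: (@measurable_fun_cvg _ _ R _ g) => [k _ A mA|[x y] _]; last first.
  apply/cvgrPdist_le => e e0; have [r r0 H] := uphi e e0.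
  near=> k; apply: H; last by rewrite subrr normr0.
  have k0 : 0 < k.+1%:R :> R by rewrite ltr0n.
  have kr : k.+1%:R^-1 < r.
    rewrite invf_plt ?posrE //.
    near: k; exists (Num.truncn r^-1) => // k /= hk.
    by apply: lt_le_trans (truncnS_gt _) _; rewrite ler_nat.
  apply: le_lt_trans kr.
  have /andP[h1 h2] := floor_itv (k.+1%:R * x); move: h2; rewrite intrD1 => h2.
  rewrite -(ler_pM2l k0) mulfV ?gt_eqF // -{1}(gtr0_norm k0) -normrM mulrBr.
  rewrite mulrCA mulfV ?gt_eqF // mulr1 ler_norml; apply/andP; split; lra.
have -> : [set: R * R] `&` g k @^-1` A = \bigcup_(z : int)
    ([set x | Num.floor (k.+1%:R * x) = z] `*`
     [set y | A (phi (z%:~R / k.+1%:R, y))]).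
  rewrite setTI; apply/seteqP; split => [[x y] /= Axy|[x y] [z _ [/= <-]] //].
  by exists (Num.floor (k.+1%:R * x)).
apply: countable_bigcupT_measurable => // z; apply: measurableX.
  have -> : [set x : R | Num.floor (k.+1%:R * x) = z] =
     `[z%:~R / k.+1%:R, (z + 1)%:~R / k.+1%:R[%classic.
    have k0 : 0 < k.+1%:R :> R by rewrite ltr0n.
    apply/seteqP; split => x /=.
      move=> <-; have := floor_itv (k.+1%:R * x).
      by rewrite in_itv /= ler_pdivrMr // ltr_pdivlMr // mulrC.
    rewrite in_itv /= ler_pdivrMr // ltr_pdivlMr // mulrC => h.
    exact: floor_def.
  exact: measurable_itv.
rewrite -[X in measurable X]setTI.
apply: (@continuous_measurable_fun R (fun y => phi (z%:~R / k.+1%:R, y))) => //.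
by apply: ucont2_comp => //; exact: cst_continuous.
Unshelve. all: by end_near. Qed.

(** * Weak decay against continuous, then integrable, weights *)

Lemma segint_split (R : realType) (h : R) (N : nat) (w : R -> R) :
  continuous w -> 0 <= h ->
  segint 0 (N%:R * h) w = \sum_(i < N) segint (i%:R * h) (i.+1%:R * h) w.
Proof.
move=> cw h0; elim: N => [|N IH].
  by rewrite big_ord0 mul0r set_itv1 Rintegral_set1.
rewrite big_ord_recr /= -IH segint_chasles //; first by rewrite mulr_ge0.
by rewrite ler_wpM2r // ler_nat.
Qed.

(** On [N] short cells the first argument of [psi] and the weight [g] are frozen at the left
    endpoint. Freezing costs at most e / 2 in total, and what remains on each cell is a constant
    times an integral of a mean-zero function of the orbit sum. *)
Lemma orbit_weak_decay_continuous (R : realType) (alpha k C e c : R) (F : R -> R)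
  (d : int) (psi : R * R -> R) (g : R -> R) :
  (forall q : rat, alpha != ratr q) ->
  (forall x y, `|F x - F y| <= k * `|x - y|) ->
  (forall x, F (x + 1) = F x + d%:~R) -> d != 0 ->
  ucont2 R psi -> periodic2 R psi -> (forall z, `|psi z| <= C) ->
  (forall x, segint 0 1 (fun y => psi (x, y)) = 0) -> continuous g -> 0 < e ->
  exists N0 : nat, forall n, (N0 <= n)%N ->
    `|segint 0 1 (fun x => psi (x + n%:R * alpha, c + orbit_sum R alpha F n x) * g x)|
    <= e.
Proof.
move=> irr lF pF d0 upsi ppsi psiC psi0 cg e0.
have C0 : 0 <= C by apply: le_trans (psiC 0).
have [G G0 gG] := compact_norm_bound R _ _ g (@segment_compact R 0 1) cg.
pose e1 := e / 2 / (C + G + 1).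
have CG : 0 < C + G + 1 by lra.
have e10 : 0 < e1 by rewrite !divr_gt0.
have e1E : e1 * (C + G) <= e / 2.
  by rewrite /e1 mulrAC ler_pdivrMr // ler_wpM2l; lra.
have [r1 r10 hpsi] := upsi e1 e10.
have [r2 r20 hg] := compact_unif_continuous R _ _ g e1 (@segment_compact R 0 1) cg e10.
pose N := (Num.truncn (Num.min r1 r2)^-1).+1; pose h : R := N%:R^-1.
have N0 : 0 < N%:R :> R by rewrite ltr0n.
have h0 : 0 < h by rewrite invr_gt0.
have hmin : h < Num.min r1 r2.
  by rewrite invf_plt ?posrE ?lt_min ?r10 ?r20 //; exact: truncnS_gt.
have [hr1 hr2] : h < r1 /\ h < r2 by move: hmin; rewrite lt_min => /andP[].
pose e2 := e / 2 / (N%:R * (G + 1)).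
have e20 : 0 < e2 by rewrite !divr_gt0 // mulr_gt0 //; lra.
have [N1 HN1] := orbit_sum_weak_decay R alpha k C e2 F d irr lF pF d0 C0 e20.
exists N1 => n nN1.
set S := orbit_sum R alpha F n.
have cS : continuous S.
  apply: ucont_continuous; apply: lipschitz_ucont => x y.
  exact: (@orbit_sum_lipschitz R alpha k).
have cid : continuous (fun x : R => x) by move=> x; exact: cvg_id.
have ccS : continuous (fun x => c + S x) by apply: continuous_addr => //; exact: cst_continuous.
set u := fun x => psi (x + n%:R * alpha, c + S x).
have cu : continuous u.
  by apply: ucont2_comp => //; exact: (continuous_shiftr R _ (fun x => x) cid).
have cug : continuous (fun x => u x * g x) by exact: continuous_mulr.
have hN : N%:R * h = 1 by rewrite mulfV // gt_eqF.
have E := segint_split R h N (fun x => u x * g x) cug (ltW h0); rewrite hN in E.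
rewrite E {E}; apply: le_trans (ler_norm_sum _ _ _) _.
rewrite (_ : e = e / N%:R * N%:R); last by field; rewrite gt_eqF.
rewrite (mulr_natr_sum R _ N); apply: ler_sum => i _.
set a := i%:R * h; set b := i.+1%:R * h.
have ab : b - a = h by rewrite /a /b -natr1; ring.
have a0 : 0 <= a by rewrite mulr_ge0 // ltW.
have b1 : b <= 1 by rewrite -hN ler_pM2r // ler_nat.
have leab : a <= b by lra.
(* This function changes with [n] as well as with the cell, hence the need for decay uniform over
   [w]. *)
pose w y := psi (a + n%:R * alpha, c + y).
have cwS : continuous (fun x => w (S x)).
  by apply: ucont2_comp => //; exact: cst_continuous.
have h1 : `|segint a b (fun x => w (S x))| <= e2.
  apply: HN1 => //; first exact: ucont2_section.
  - by move=> x; rewrite /w addrA; exact: (ppsi _ _).2.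
  - rewrite -[RHS](psi0 (a + n%:R * alpha)).
    rewrite -[RHS](@segint_periodic_shift R c (fun y => psi (a + n%:R * alpha, y))).
    + by congr Rintegral; apply/funext => y; rewrite /w [c + y]addrC.
    + by apply: ucont2_comp => //; exact: cst_continuous.
    + by move=> y; exact: (ppsi _ _).2.
  - by move=> x; exact: psiC.
have cgaw : continuous (fun x => g a * w (S x)).
  by apply: continuous_mulr => //; exact: cst_continuous.
have h2 : `|segint a b (fun x => u x * g x - g a * w (S x))| <= e1 * (C + G) * (b - a).
  apply: segint_bound => //; first exact: continuous_subr.
  move=> x /andP[ax xb].
  have -> : u x * g x - g a * w (S x) = (u x - w (S x)) * g x - w (S x) * (g a - g x).
    by ring.
  apply: le_trans (ler_normB _ _) _; rewrite !normrM mulrDr addrC; apply: lerD.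
    rewrite [leRHS]mulrC; apply: ler_pM => //; first exact: psiC.
    apply: hg; first by rewrite /= in_itv /=; lra.
    by rewrite /ball /= distrC ger0_norm; lra.
  apply: ler_pM => //; last by apply: gG; rewrite /= in_itv /=; lra.
  apply: hpsi; last by rewrite subrr normr0.
  by rewrite (_ : _ - _ = x - a); [rewrite ger0_norm; lra|ring].
rewrite segint_B // (@segint_Z R a b (g a) (fun x => w (S x))) // in h2.
have h3 : `|g a * segint a b (fun x => w (S x))| <= e / 2 / N%:R.
  rewrite normrM; apply: (@le_trans _ _ (G * e2)).
    by apply: ler_pM => //; apply: gG; rewrite /= in_itv /=; lra.
  rewrite /e2 mulrA ler_pdivrMr ?mulr_gt0 //; last lra.
  rewrite (_ : e / 2 / N%:R * (N%:R * (G + 1)) = e / 2 * (G + 1)); first nra.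
  by field; rewrite gt_eqF.
have h4 : e1 * (C + G) * (b - a) <= e / 2 / N%:R by rewrite ab ler_wpM2r // ltW.
have -> : e / N%:R = e / 2 / N%:R + e / 2 / N%:R by field; rewrite gt_eqF.
set I1 := segint a b _ in h2 *; set I2 := segint a b _ in h2 h3.
rewrite -[I1](subrK (g a * I2)); apply: le_trans (ler_normD _ _) _.
by apply: lerD => //; exact: le_trans h4.
Qed.

(** Continuous functions are dense in L^1, and the uniform bound [C] on the [u n] controls the
    replacement of [h] by a continuous weight for all [n] at once. *)
Lemma weak_decay_integrable (R : realType) (C : R) (u : nat -> R -> R) (h : R -> R) :
  (forall n, continuous (u n)) -> (forall n x, `|u n x| <= C) ->
  (forall (g : R -> R) (e : R), continuous g -> 0 < e -> exists N0 : nat,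
    forall n, (N0 <= n)%N -> `|segint 0 1 (fun x => u n x * g x)| <= e) ->
  (@lebesgue_measure R).-integrable `[0, 1] (EFin \o h) ->
  forall e : R, 0 < e -> exists N0 : nat, forall n, (N0 <= n)%N ->
    `|segint 0 1 (fun x => u n x * h x)| <= e.
Proof.
move=> cu uC Hg ih e e0.
have C0 : 0 <= C by apply: le_trans (uC 0%N 0).
have m01 : ((@lebesgue_measure R) `[0%R, 1%R]%classic < +oo)%E.
  have E : (@lebesgue_measure R) `[0, 1]%classic = 1%:E.
    apply: etrans (@lebesgue_measure_itv R (Interval (BLeft 0) (BRight 1))) _.
    by rewrite /= lte_fin ltr01 oppr0 adde0.
  by rewrite E ltry.
have [g_ [cg ig Hlim]] := approximation_continuous_integrable
  (measurable_itv `[0, 1]) m01 ih.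
have e1 : 0 < e / 2 / (C + 1) by rewrite !divr_gt0 //; lra.
have [m hm] : exists m, segint 0 1 (fun x => `|h x - g_ m x|) <= e / 2 / (C + 1).
  have /fine_cvgP[_ /cvgrPdist_le/(_ _ e1)[m _ /(_ m (leqnn m))]] := Hlim.
  rewrite /= sub0r normrN => H; exists m.
  by apply: le_trans H; apply: le_trans (ler_norm _) _.
have e2 : 0 < e / 2 by rewrite divr_gt0.
have [N0 HN0] := Hg (g_ m) _ (cg m) e2.
exists N0 => n nN0.
have bu : [bounded u n x | x in `[0, 1]%classic : set R].
  exists C; split; first exact: num_real.
  by move=> t Ct x _; exact: le_trans (uC n x) (ltW Ct).
have mu_ : measurable_fun (T := measurableTypeR R) `[0, 1]%classic (u n).
  by apply: measurable_funTS; exact: continuous_measurable_fun.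
have iuh : (@lebesgue_measure R).-integrable `[0, 1] (EFin \o (fun x => u n x * h x)).
  exact: (integrableMr (mu := lebesgue_measure) (measurable_itv `[0, 1]) mu_ bu ih).
have iug : (@lebesgue_measure R).-integrable `[0, 1] (EFin \o (fun x => u n x * g_ m x)).
  exact: (integrableMr (mu := lebesgue_measure) (measurable_itv `[0, 1]) mu_ bu (ig m)).
have ihg : (@lebesgue_measure R).-integrable `[0, 1] (EFin \o (fun x => h x - g_ m x)).
  exact: (integrableB (mu := lebesgue_measure) (measurable_itv `[0, 1]) ih (ig m)).
have inhg : (@lebesgue_measure R).-integrable `[0, 1] (EFin \o (fun x => `|h x - g_ m x|)).
  exact: (integrable_norm (mu := lebesgue_measure) ihg).
have iuhg : (@lebesgue_measure R).-integrable `[0, 1]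
    (EFin \o (fun x => u n x * h x - u n x * g_ m x)).
  exact: (integrableB (mu := lebesgue_measure) (measurable_itv `[0, 1]) iuh iug).
have : `|segint 0 1 (fun x => u n x * h x) - segint 0 1 (fun x => u n x * g_ m x)| <= e / 2.
  rewrite -RintegralB //; apply: le_trans (le_normr_Rintegral _ iuhg) _ => //.
  apply: (@le_trans _ _ (segint 0 1 (fun x => C * `|h x - g_ m x|))).
    apply: le_Rintegral => //.
    - exact: (integrable_norm (mu := lebesgue_measure) iuhg).
    - exact: (integrableZl (mu := lebesgue_measure) (measurable_itv `[0, 1]) C inhg).
    - by move=> x _; rewrite -mulrBr normrM ler_wpM2r.
  rewrite RintegralZl //; apply: (@le_trans _ _ (C * (e / 2 / (C + 1)))).
    exact: ler_wpM2l.
  by rewrite mulrA ler_pdivrMr; nra.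
have := HN0 n nN0; set I1 := segint 0 1 _; set I2 := segint 0 1 _.
rewrite !ler_norml => /andP[? ?] /andP[? ?]; apply/andP; split; lra.
Qed.

(** * Disintegration and the skew product *)

(** Restricting [mu] to the strip over [I] can only decrease its first marginal, which therefore
    stays absolutely continuous; [h] is its Radon-Nikodym density. *)
Lemma fiber_density (R : realType) (mu : probability (R * R)%type R) (I : set R) :
  (forall A : set R, measurable A ->
     mu (A `*` setT) = lebesgue_measure (A `&` `[0%R, 1%R[)) ->
  measurable I ->
  exists2 h : R -> R, (@lebesgue_measure R).-integrable `[0, 1] (EFin \o h) &
    forall U : R -> R, continuous U -> (exists C : R, forall x, `|U x| <= C) ->
    Rintegral mu (`[0, 1[%classic `*` I) (fun z => U z.1) =
    segint 0 1 (fun x => U x * h x).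
Proof.
move=> mu_proj mI.
have mTI : measurable ([set: R] `*` I : set (R * R)) by exact: measurableX.
have mfst : measurable_fun [set: R * R] (fst : R * R -> measurableTypeR R).
  exact: measurable_fst.
pose D : set (measurableTypeR R) := `[0, 1[%classic.
have mD : measurable D by exact: measurable_itv.
(* The image under [fst] of [mu] restricted to the strip; [nu] below is its restriction to [0, 1[,
   packaged as a finite measure. *)
pose nu0 := measure_function_pushforward__canonical__measure_function_Measure
  (mrestr mu mTI) mfst.
have nu0D : (nu0 D < +oo)%E.
  apply: (@le_lt_trans _ _ (mu setT)); last by rewrite probability_setT ltry.
  apply: le_measure; rewrite ?inE //; apply: measurableI => //.
  by rewrite -[X in measurable X]setTI; exact: (mfst measurableT).
pose nu : {finite_measure set (measurableTypeR R) -> \bar R} := mfrestr mD nu0D.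
have nuE A : nu A = mu ((A `&` D) `*` I).
  rewrite /nu /= /mfrestr /mrestr /nu0 /= /pushforward; congr (mu _).
  by apply/seteqP; split => [[x y] /= [[? ?] [? ?]]|[x y] /= [[? ?] ?]].
have nulam : nu `<< (@lebesgue_measure R).
  apply/null_content_dominatesP => A mA lA0; rewrite nuE.
  apply/eqP; rewrite eq_le measure_ge0 andbT -lA0.
  apply: (@le_trans _ _ (mu (A `*` setT))).
    apply: le_measure; rewrite ?inE; [|exact: measurableX|].
      by apply: measurableX => //; exact: measurableI.
    by move=> [x y] /= [[]].
  by rewrite mu_proj //; apply: le_measure; rewrite ?inE //; exact: measurableI.
pose H := Radon_Nikodym (charge_of_finite_measure nu) (@lebesgue_measure R).
have Hfin x : H x \is a fin_num by exact: Radon_Nikodym_fin_num.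
have iH : (@lebesgue_measure R).-integrable setT H by exact: Radon_Nikodym_integrable.
exists (fine \o H).
  have -> : EFin \o (fine \o H) = H by apply/funext => x /=; rewrite fineK.
  exact: (integrableS (mu := lebesgue_measure) measurableT).
move=> U cU [C UC].
have mU : measurable_fun (T := measurableTypeR R) setT U by exact: continuous_measurable_fun.
have bU (X : set R) : [bounded U x | x in X].
  exists C; split; first exact: num_real.
  by move=> t Ct x _; exact: le_trans (UC x) (ltW Ct).
have inuU : nu.-integrable D (EFin \o U).
  apply: (measurable_bounded_integrable (mu := nu)) => //.
  - by rewrite -ge0_fin_numE //; exact: fin_num_measure.
  - exact: measurable_funTS.
have mUf : measurable_fun [set: R * R] (fun z : R * R => U z.1).
  exact: (measurableT_comp mU mfst).
have mDI : measurable (D `*` I : set (R * R)) by exact: measurableX.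
have mfD : measurable (fst @^-1` D : set (R * R)).
  by rewrite -[X in measurable X]setTI; exact: (mfst measurableT).
have imrU : (mrestr mu mTI).-integrable (fst @^-1` D) (EFin \o U \o fst).
  apply: (measurable_bounded_integrable (mu := mrestr mu mTI)) => //.
  - exact: measurable_funTS.
  - exists C; split; first exact: num_real.
    by move=> t Ct x _; exact: le_trans (UC _) (ltW Ct).
rewrite /Rintegral; congr fine; apply/esym.
transitivity (\int[lebesgue_measure]_(x in D) ((EFin \o U) x * H x))%E.
  rewrite -integral_itv_bndo_bndc.
    by apply: eq_integral => x _ /=; rewrite EFinM fineK.
  have -> : (fun x => (U x * (fine \o H) x)%:E) = (fun x => ((EFin \o U) x * H x)%E).
    by apply/funext => x /=; rewrite EFinM fineK.
  apply: emeasurable_funM; first by apply/measurable_EFinP; exact: measurable_funTS.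
  by apply: measurable_funTS; exact: measurable_int iH.
rewrite Radon_Nikodym_change_of_variables //.
transitivity (\int[nu0]_(x in D) (EFin \o U) x)%E.
  by apply: eq_measure_integral => A mA AD; rewrite /nu /= /mfrestr /mrestr setIidl.
rewrite integral_pushforward //; last by apply/measurable_EFinP.
(* The complement of the strip is null for the restricted measure; removing it turns the domain of
   integration into [D] times [I]. *)
rewrite (@negligible_integral _ _ _ (mrestr mu mTI) _ (~` ([set: R] `*` I))) //; last 2 first.
- exact: measurableC.
- by rewrite /= /mrestr setICl measure0.
have -> : fst @^-1` D `\` ~` ([set: R] `*` I) = D `*` I.
  apply/seteqP; split => [[x y] /= [Dx /contrapT []]|[x y] /= [? ?]] //.
  by split => // nTI; apply: nTI.
apply: eq_measure_integral => A mA AD; rewrite /= /mrestr setIidl //.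
by apply: subset_trans AD _ => -[x y] [].
Qed.

(** * Fibre means and centring *)

Definition fiber_mean (R : realType) (phi : R * R -> R) (x : R) :=
  segint 0 1 (fun y => phi (x, y)).

Lemma ucont2_fiber (R : realType) (phi : R * R -> R) (x : R) :
  ucont2 R phi -> continuous (fun y => phi (x, y)).
Proof.
move=> uphi; apply: ucont2_comp => //; first exact: cst_continuous.
by move=> y; exact: cvg_id.
Qed.

Lemma fiber_mean_ucont (R : realType) (phi : R * R -> R) :
  ucont2 R phi -> ucont R (fiber_mean R phi).
Proof.
move=> uphi e e0; have [r r0 H] := uphi e e0; exists r => // x y xy.
rewrite /fiber_mean -segint_B; try exact: ucont2_fiber.
rewrite -[leRHS]mulr1 -[X in e * X]subr0; apply: segint_bound => //.
  by apply: continuous_subr; exact: ucont2_fiber.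
by move=> z _; apply: H => //; rewrite subrr normr0.
Qed.

Lemma fiber_mean_bound (R : realType) (phi : R * R -> R) (M : R) x :
  ucont2 R phi -> (forall z, `|phi z| <= M) -> `|fiber_mean R phi x| <= M.
Proof.
move=> uphi phiM; rewrite -[leRHS]mulr1 -[X in M * X]subr0.
by apply: segint_bound => //; exact: ucont2_fiber.
Qed.

Lemma fiber_mean_periodic (R : realType) (phi : R * R -> R) x :
  periodic2 R phi -> fiber_mean R phi (x + 1) = fiber_mean R phi x.
Proof.
move=> pphi; congr Rintegral; apply/funext => y; exact: (pphi _ _).1.
Qed.

Definition centered (R : realType) (phi : R * R -> R) (z : R * R) :=
  phi z - fiber_mean R phi z.1.

Lemma centered_ucont2 (R : realType) (phi : R * R -> R) :
  ucont2 R phi -> ucont2 R (centered R phi).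
Proof.
move=> uphi e e0; have e20 : 0 < e / 2 by rewrite divr_gt0.
have [r r0 H] := uphi _ e20; have [s s0 H'] := fiber_mean_ucont R phi uphi _ e20.
exists (Num.min r s); first by rewrite lt_min r0.
move=> x y x' y'; rewrite !lt_min => /andP[xr xs] /andP[yr ys].
have := H x y x' y' xr yr; have := H' x x' xs; rewrite /centered /=.
rewrite !ler_norml => /andP[? ?] /andP[? ?]; apply/andP; split; lra.
Qed.

Lemma centered_periodic2 (R : realType) (phi : R * R -> R) :
  periodic2 R phi -> periodic2 R (centered R phi).
Proof.
move=> pphi x y; rewrite /centered /= fiber_mean_periodic //.
by have [-> ->] := pphi x y.
Qed.

Lemma centered_bound (R : realType) (phi : R * R -> R) (M : R) z :
  ucont2 R phi -> (forall z, `|phi z| <= M) -> `|centered R phi z| <= M + M.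
Proof.
move=> uphi phiM; apply: le_trans (ler_normB _ _) _.
by apply: lerD => //; exact: fiber_mean_bound.
Qed.

Lemma centered_mean0 (R : realType) (phi : R * R -> R) x :
  ucont2 R phi -> segint 0 1 (fun y => centered R phi (x, y)) = 0.
Proof.
move=> uphi; rewrite /centered /= segint_B; last 2 first.
- exact: ucont2_fiber.
- exact: cst_continuous.
by rewrite segint_cst ?ler01 // subr0 mulr1 subrr.
Qed.

(** * Decay along the iterates of the skew product *)

Lemma iter_skew_lift (R : realType) (alpha : R) (F : R -> R) n x y :
  iter n (skew_lift alpha F) (x, y) =
  (x + n%:R * alpha, y + orbit_sum R alpha F n x).
Proof.
elim: n => [|n IH].
  by rewrite /= mul0r addr0 /orbit_sum big_ord0 addr0.
rewrite iterS IH /skew_lift /= /orbit_sum big_ord_recr /= addrA.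
by congr (_, _); rewrite -natr1; ring.
Qed.

Lemma skew_ucont2 (R : realType) (a k : R) (S : R -> R) (psi : R * R -> R) :
  (forall x y, `|S x - S y| <= k * `|x - y|) -> ucont2 R psi ->
  ucont2 R (fun z => psi (z.1 + a, z.2 + S z.1)).
Proof.
move=> lS upsi e e0; have [r r0 H] := upsi e e0.
have [s s0 HS] := lipschitz_ucont R k S lS (r / 2 / 2) ltac:(lra).
exists (Num.min s (r / 2)); first by rewrite lt_min s0 divr_gt0.
move=> x y x' y' /=; rewrite !lt_min => /andP[xs xr] /andP[_ yr].
apply: H; first by rewrite opprD addrACA subrr addr0; lra.
have := HS x x' xs; rewrite opprD addrACA.
have := ler_normD (y - y') (S x - S x'); lra.
Qed.

Lemma bounded_integrable_probability (R : realType) (dT : measure_display)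
  (T : measurableType dT) (mu : probability T R) (D : set T) (f : T -> R) (C : R) :
  measurable D -> measurable_fun setT f -> (forall x, `|f x| <= C) ->
  mu.-integrable D (EFin \o f).
Proof.
move=> mD mf fC; apply: (measurable_bounded_integrable (mu := mu)) => //.
- by rewrite -ge0_fin_numE //; exact: fin_num_measure.
- exact: measurable_funTS.
- exists C; split; first exact: num_real.
  by move=> t Ct x _; exact: le_trans (fC _) (ltW Ct).
Qed.

Lemma Rintegral_norm_bound (R : realType) (dT : measure_display)
  (T : measurableType dT) (mu : probability T R) (D : set T) (f : T -> R) (C : R) :
  measurable D -> mu.-integrable D (EFin \o f) -> (forall x, D x -> `|f x| <= C) ->
  `|Rintegral mu D f| <= C * fine (mu D).
Proof.
move=> mD fi fC; apply: le_trans (le_normr_Rintegral mD fi) _.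
rewrite -(Rintegral_cst mu mD); apply: le_Rintegral => //.
  exact: (integrable_norm (mu := mu) fi).
apply: (@bounded_integrable_probability _ _ _ _ _ _ `|C|) => //.
Qed.

Lemma uniform_rank (P : nat -> nat -> Prop) (N : nat) :
  (forall j, exists N0, forall n, (N0 <= n)%N -> P j n) ->
  exists N0, forall n, (N0 <= n)%N -> forall j, (j < N)%N -> P j n.
Proof.
move=> H; elim: N => [|N [N0 IH]]; first by exists 0%N.
have [N1 H1] := H N; exists (maxn N0 N1) => n; rewrite geq_max => /andP[n0 n1] j.
by rewrite ltnS leq_eqVlt => /predU1P[->|/IH]; [exact: H1|exact].
Qed.

Lemma skew_decay (R : realType) (alpha k C e : R) (F : R -> R) (d : int)
  (mu : probability (R * R)%type R) (psi : R * R -> R) :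
  (forall q : rat, alpha != ratr q) ->
  (forall x y, `|F x - F y| <= k * `|x - y|) ->
  (forall x, F (x + 1) = F x + d%:~R) -> d != 0 ->
  (forall A : set R, measurable A ->
     mu (A `*` setT) = lebesgue_measure (A `&` `[0%R, 1%R[)) ->
  ucont2 R psi -> periodic2 R psi -> (forall z, `|psi z| <= C) ->
  (forall x, segint 0 1 (fun y => psi (x, y)) = 0) -> 0 < e ->
  exists N0 : nat, forall n, (N0 <= n)%N ->
    `|Rintegral mu (@unit_square R) (fun z =>
        psi (z.1 + n%:R * alpha, z.2 + orbit_sum R alpha F n z.1))| <= e.
Proof.
move=> irr lF pF d0 mu_proj upsi ppsi psiC psi0 e0.
have e20 : 0 < e / 2 by rewrite divr_gt0.
have [r r0 hr] := upsi _ e20.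
pose N := (Num.truncn r^-1).+1; pose h : R := N%:R^-1.
have N0 : 0 < N%:R :> R by rewrite ltr0n.
have h0 : 0 < h by rewrite invr_gt0.
have hN : N%:R * h = 1 by rewrite mulfV // gt_eqF.
have hrr : h < r by rewrite invf_plt ?posrE //; exact: truncnS_gt.
pose I (j : nat) : set R := `[j%:R * h, j.+1%:R * h[%classic.
have mI j : measurable (I j) by exact: measurable_itv.
pose B j : set (R * R) := `[0, 1[%classic `*` I j.
pose A j : set (R * R) := `[0, 1[%classic `*` `[0, j%:R * h[%classic.
have mB j : measurable (B j) by apply: measurableX.
have mA j : measurable (A j) by apply: measurableX.
pose u (j n : nat) x := psi (x + n%:R * alpha, j%:R * h + orbit_sum R alpha F n x).
have cS n : continuous (orbit_sum R alpha F n).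
  apply: ucont_continuous; apply: lipschitz_ucont => x y.
  exact: (@orbit_sum_lipschitz R alpha k).
have cid : continuous (fun x : R => x) by move=> x; exact: cvg_id.
have cu j n : continuous (u j n).
  apply: ucont2_comp => //; first exact: (continuous_shiftr R _ (fun x => x) cid).
  by apply: continuous_addr => //; exact: cst_continuous.
have eN : 0 < e / 2 / N%:R by rewrite divr_gt0.
have [N1 HN1] : exists N1, forall n, (N1 <= n)%N -> forall j, (j < N)%N ->
    `|Rintegral mu (B j) (fun z => u j n z.1)| <= e / 2 / N%:R.
  apply: (uniform_rank (fun j n => `|Rintegral mu (B j) (fun z => u j n z.1)| <= e / 2 / N%:R)).
  move=> j; have [hj ihj Hj] := fiber_density R mu (I j) mu_proj (mI j).
  have [||N0' H] := weak_decay_integrable R C (u j) hj (cu j) _ _ ihj _ eN.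
  - by move=> n x; exact: psiC.
  - move=> g e' cg e'0; exact: (orbit_weak_decay_continuous R alpha k C e' (j%:R * h) F d).
  - by exists N0' => n /H; rewrite Hj //; exists C => x; exact: psiC.
exists N1 => n nN1.
set W := fun z : R * R => psi (z.1 + n%:R * alpha, z.2 + orbit_sum R alpha F n z.1).
have uW : ucont2 R W.
  apply: (@skew_ucont2 R _ (n%:R * k)) => // x y; exact: orbit_sum_lipschitz.
have mW : measurable_fun setT W by exact: ucont2_measurable.
have iW D : measurable D -> mu.-integrable D (EFin \o W).
  by move=> mD; apply: (@bounded_integrable_probability _ _ _ _ _ _ C) => // z; exact: psiC.
have iu j D : measurable D -> mu.-integrable D (EFin \o (fun z : R * R => u j n z.1)).
  move=> mD; apply: (@bounded_integrable_probability _ _ _ _ _ _ C) => //; last first.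
    by move=> z; exact: psiC.
  apply: (measurableT_comp _ measurable_fst).
  exact: continuous_measurable_fun.
have hB j : (j < N)%N -> `|Rintegral mu (B j) W| <= e / 2 * fine (mu (B j)) + e / 2 / N%:R.
  move=> jN; have := HN1 n nN1 j jN.
  have : `|Rintegral mu (B j) (fun z => W z - u j n z.1)| <= e / 2 * fine (mu (B j)).
    apply: Rintegral_norm_bound => //.
      exact: (integrableB (mu := mu) (mB j) (iW _ (mB j)) (iu j _ (mB j))).
    move=> [x y] [/= _]; rewrite /I /= in_itv /= => /andP[y1 y2].
    apply: hr; first by rewrite subrr normr0.
    rewrite /= opprD addrACA subrr addr0 ger0_norm; last lra.
    by move: y2; rewrite -natr1 mulrDl mul1r; lra.
  rewrite RintegralB //; [|exact: iW|exact: iu].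
  set I1 := Rintegral _ _ _; set I2 := Rintegral _ _ _.
  rewrite !ler_norml => /andP[? ?] /andP[? ?]; apply/andP; split; lra.
(* The strips are added one at a time; as freezing errors are weighted by mass, they add up to at
   most e / 2 whatever [N] is. *)
have hA j : (j <= N)%N ->
    `|Rintegral mu (A j) W| <= e / 2 * fine (mu (A j)) + j%:R * (e / 2 / N%:R).
  elim: j => [_|j IH jN].
    rewrite (_ : A 0%N = set0); first by rewrite Rintegral_set0 measure0 normr0 mul0r addr0 mulr0.
    apply/seteqP; split => // -[x y] [/= _]; rewrite in_itv /= mul0r.
    by move=> /andP[? ?]; lra.
  have AE : A j.+1 = A j `|` B j.
    rewrite /A /B /I (@itv_bndbnd_setU _ _ (BLeft 0) (BLeft (j%:R * h)) (BLeft (j.+1%:R * h))).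
    - apply/seteqP; split.
        by move=> [x y] [/= Hx [Hy|Hy]]; [left|right].
      by move=> [x y] [[/= Hx Hy]|[/= Hx Hy]]; split => //; [left|right].
    - by rewrite bnd_simp mulr_ge0 // ltW.
    - by rewrite bnd_simp ler_pM2r // ler_nat.
  have AB0 : A j `&` B j = set0.
    apply/seteqP; split => // -[x y] [[/= _]]; rewrite in_itv /= => /andP[_ y1] [_].
    by rewrite /I /= in_itv /= => /andP[y2 _]; lra.
  rewrite AE Rintegral_setU //; last 2 first.
  - by apply: iW; exact: measurableU.
  - exact/disj_set2P.
  rewrite measureU // fineD; [|exact: fin_num_measure..].
  apply: le_trans (ler_normD _ _) _.
  have := IH (ltnW jN); have := hB j jN; rewrite -(natr1 j) mulrDl mul1r mulrDr; lra.
have -> : @unit_square R = A N by rewrite /A hN.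
apply: le_trans (hA N (leqnn N)) _.
have mu1 : fine (mu (A N)) <= 1.
  rewrite -lee_fin fineK ?fin_num_measure //; exact: probability_le1.
have -> : N%:R * (e / 2 / N%:R) = e / 2 by field; rewrite gt_eqF.
nra.
Qed.

(** * Marginals and integrals over the unit square *)

Lemma measurable_unit_square (R : realType) : measurable (@unit_square R).
Proof. by apply: measurableX; exact: measurable_itv. Qed.

Lemma Rintegral_full_measure (R : realType) (dT : measure_display)
  (T : measurableType dT) (mu : probability T R) (Q X : set T) (f : T -> R) :
  measurable Q -> measurable X -> mu (~` Q) = 0%E -> Q `<=` X ->
  mu.-integrable X (EFin \o f) -> Rintegral mu X f = Rintegral mu Q f.
Proof.
move=> mQ mX muQ QX fi; rewrite /Rintegral; congr fine.
rewrite (@negligible_integral _ _ _ mu X (~` Q)) //; last exact: measurableC.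
by rewrite setDE setCK setIC setIidl.
Qed.

Lemma marginal_Rintegral (R : realType) (mu : probability (R * R)%type R)
  (U : R -> R) (C : R) :
  (forall A : set R, measurable A ->
     mu (A `*` setT) = lebesgue_measure (A `&` `[0%R, 1%R[)) ->
  continuous U -> (forall x, `|U x| <= C) ->
  Rintegral mu (`[0, 1[%classic `*` setT) (fun z => U z.1) = segint 0 1 U.
Proof.
move=> mu_proj cU UC.
have mfst : measurable_fun [set: R * R] (fst : R * R -> measurableTypeR R).
  exact: measurable_fst.
pose D : set (measurableTypeR R) := `[0, 1[%classic.
have mD : measurable D by exact: measurable_itv.
have mU : measurable_fun (T := measurableTypeR R) setT U by exact: continuous_measurable_fun.
have mUf : measurable_fun [set: R * R] (fun z : R * R => U z.1).
  exact: (measurableT_comp mU mfst).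
have fstD : fst @^-1` D = `[0, 1[%classic `*` [set: R].
  by apply/seteqP; split => [[x y] /= ?|[x y] /= []].
have mDT : measurable (fst @^-1` D : set (R * R)).
  by rewrite -[X in measurable X]setTI; exact: (mfst measurableT).
rewrite /Rintegral; congr fine; rewrite -fstD.
rewrite -[LHS](@integral_pushforward _ _ _ _ _ _ mfst mu D (EFin \o U)) //; last 2 first.
- exact/measurable_EFinP.
- by apply: (@bounded_integrable_probability _ _ _ _ _ _ C).
rewrite -integral_itv_bndo_bndc; last by apply/measurable_EFinP; exact: measurable_funTS.
apply: eq_measure_integral => A mA AD.
rewrite /= /pushforward.
have -> : fst @^-1` A = A `*` [set: R].
  by apply/seteqP; split => [[x y] /= ?|[x y] /= []].
by rewrite mu_proj // setIidl.
Qed.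

Lemma unit_square_integral (R : realType) (phi : R * R -> R) (M : R) :
  ucont2 R phi -> (forall z, `|phi z| <= M) ->
  (\int[(lebesgue_measure \x lebesgue_measure)%E]_(z in @unit_square R) (phi z)%:E)%E
  = (segint 0 1 (fiber_mean R phi))%:E.
Proof.
move=> uphi phiM.
pose D : set (measurableTypeR R) := `[0, 1[%classic.
have mD : measurable D by exact: measurable_itv.
have mphi : measurable_fun [set: R * R] phi by exact: ucont2_measurable.
have mQ := measurable_unit_square R.
have lD : (@lebesgue_measure R) D = 1%:E.
  apply: etrans (@lebesgue_measure_itv R (Interval (BLeft 0) (BLeft 1))) _.
  by rewrite /= lte_fin ltr01 oppr0 adde0.
have lQ : ((lebesgue_measure \x lebesgue_measure)%E (@unit_square R) < +oo)%E.
  have -> : (lebesgue_measure \x lebesgue_measure)%E (@unit_square R)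
      = (lebesgue_measure D * lebesgue_measure D)%E by exact: product_measure1E.
  by rewrite lD mule1 ltry.
pose lam2 := (lebesgue_measure \x lebesgue_measure :
  {measure set (measurableTypeR R * measurableTypeR R) -> \bar R})%E.
have iphi : lam2.-integrable (@unit_square R) (EFin \o phi).
  apply: (measurable_bounded_integrable (mu := lam2)) => //.
    exact: measurable_funTS.
  exists M; split; first exact: num_real.
  by move=> t Ct x _; exact: le_trans (phiM _) (ltW Ct).
have iphiT := (integrable_mkcond (mu := lam2) (EFin \o phi) mQ).1 iphi.
(* Fubini is applied to [phi] extended by zero off the square, so that the fibres over points
   outside [0, 1[ contribute nothing. *)
rewrite integral_mkcond -(integral12_prod_meas1 iphiT).
transitivity (\int[lebesgue_measure]_(x in D) (fiber_mean R phi x)%:E)%E.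
  rewrite [RHS]integral_mkcond; apply: eq_integral => x _.
  rewrite /fubini_F patchE; case: ifPn => xD.
    rewrite /fiber_mean /Rintegral fineK; last first.
      apply: integrable_fin_num => //; apply: continuous_integrable_itv.
      exact: (ucont2_fiber R phi x uphi).
    have mf : measurable_fun (T := measurableTypeR R) setT (fun y => phi (x, y)).
      by apply: continuous_measurable_fun; exact: (ucont2_fiber R phi x uphi).
    rewrite -integral_itv_bndo_bndc; last first.
      by apply/measurable_EFinP; exact: measurable_funTS.
    rewrite [RHS]integral_mkcond; apply: eq_integral => y _; rewrite !patchE.
    by rewrite /unit_square in_setX xD.
  apply: integral0_eq => y _; rewrite patchE /unit_square in_setX.
  by rewrite (negbTE xD).
have cm := ucont_continuous _ _ (fiber_mean_ucont R phi uphi).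
have mf : measurable_fun (T := measurableTypeR R) setT (fiber_mean R phi).
  exact: continuous_measurable_fun.
rewrite integral_itv_bndo_bndc; last first.
  by apply/measurable_EFinP; exact: measurable_funTS.
rewrite /Rintegral fineK //; apply: integrable_fin_num => //.
exact: continuous_integrable_itv.
Qed.

Theorem theorem1p5 (R : realType) (alpha : R) (F : R -> R) (d : int)
  (alpha_irr : forall q : rat, alpha != ratr q)
  (F_lift : forall x : R, F (x + 1) = F x + d%:~R)
  (F_deg : d != 0)
  (F_lip : exists k : R, forall x y : R, `|F x - F y| <= k * `|x - y|)
  (mu : probability (R * R)%type R)
  (mu_supp : mu (~` @unit_square R) = 0%E)
  (mu_proj : forall A : set R, measurable A ->
     mu (A `*` setT) = lebesgue_measure (A `&` `[0%R, 1%R[))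
  (phi : R * R -> R) (phi_cont : continuous phi)
  (phi_per : forall x y : R, phi (x + 1, y) = phi (x, y) /\ phi (x, y + 1) = phi (x, y)) :
  (fun n : nat => (\int[mu]_z (phi (iter n (skew_lift alpha F) z))%:E)%E) @ \oo -->
    (\int[(lebesgue_measure \x lebesgue_measure)%E]_(z in @unit_square R) (phi z)%:E)%E.
Proof.
have [k lF] := F_lip.
have uphi := periodic2_ucont R phi phi_cont phi_per.
have [M M0 phiM] := periodic2_bound R phi phi_cont phi_per.
rewrite (unit_square_integral R phi M) //.
have cm := ucont_continuous _ _ (fiber_mean_ucont R phi uphi).
have mQ := measurable_unit_square R.
pose G n (z : R * R) := phi (z.1 + n%:R * alpha, z.2 + orbit_sum R alpha F n z.1).
have -> : (fun n : nat => (\int[mu]_z (phi (iter n (skew_lift alpha F) z))%:E)%E) =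
    (fun n => (\int[mu]_z (G n z)%:E)%E).
  by apply/funext => n; apply: eq_integral => -[x y] _; rewrite iter_skew_lift.
have iG n X : measurable X -> mu.-integrable X (EFin \o G n).
  move=> mX; apply: (@bounded_integrable_probability _ _ _ _ _ _ M) => //.
    apply: ucont2_measurable; apply: (@skew_ucont2 R _ (n%:R * k)) => //.
    by move=> x y; exact: orbit_sum_lipschitz.
  by move=> z; exact: phiM.
(* Convergence in the extended reals splits into finiteness and convergence of the real values. *)
apply/fine_cvgP; split.
  by near=> n; apply: integrable_fin_num => //; exact: iG.
apply/cvgrPdist_le => e e0.
have [N0 HN0] := skew_decay R alpha k (M + M) e F d mu (centered R phi) alpha_irr lF
  F_lift F_deg mu_proj (centered_ucont2 R phi uphi) (centered_periodic2 R phi phi_per)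
  (fun z => centered_bound R phi M z uphi phiM) (fun x => centered_mean0 R phi x uphi) e0.
exists N0 => // n /= nN0.
(* [G n z - U z.1] is the centred function evaluated at the n-th iterate. *)
pose U x := fiber_mean R phi (x + n%:R * alpha).
have cU : continuous U by exact: (continuous_shiftr R _ (fiber_mean R phi) cm).
have UM x : `|U x| <= M by exact: fiber_mean_bound.
have iU X : measurable X -> mu.-integrable X (EFin \o (fun z : R * R => U z.1)).
  move=> mX; apply: (@bounded_integrable_probability _ _ _ _ _ _ M) => //.
  apply: (measurableT_comp _ measurable_fst); exact: continuous_measurable_fun.
have -> : fine (\int[mu]_z (G n z)%:E)%E = Rintegral mu (@unit_square R) (G n).
  by apply: Rintegral_full_measure => //; exact: iG.
(* The integral of the fibre means against [mu] is independent of [n], because the first marginal is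
   Lebesgue measure and periodic functions have rotation-invariant integrals. *)
have -> : segint 0 1 (fiber_mean R phi) = Rintegral mu (@unit_square R) (fun z => U z.1).
  rewrite -(@segint_periodic_shift R (n%:R * alpha)) //; last first.
    by move=> x; exact: fiber_mean_periodic.
  rewrite -(marginal_Rintegral R mu U M) //.
  have mDT : measurable (`[0, 1[%classic `*` [set: R] : set (R * R)).
    by apply: measurableX.
  apply: Rintegral_full_measure => //; last exact: iU.
  by move=> [x y] [].
rewrite distrC -RintegralB //; [|exact: iG|exact: iU].
exact: HN0.
Unshelve. all: by end_near. Qed.
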